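(* The perfect protection problem is NP-hard.
   Context: Instance: a finite undirected connected graph $(V,E)$ (edges are unordered pairs of two nodes), sets $\mathcal{M}^I\subseteq V$, $\mathcal{M}^L\subseteq E$, $\mathcal{M}^P\subseteq V$, and costs $c^I_i$ ($i\in\mathcal{M}^I$), $c^L_j$ ($j\in\mathcal{M}^L$), $c^P_k$ ($k\in\mathcal{M}^P$) (rational numbers). The perfect protection problem is to choose binary variables $x_i\in\{0,1\}$ ($i\in V$), $y_j\in\{0,1\}$ ($j\in E$), $z_k\in\{0,1\}$ ($k\in V$), with $x_i=0$ for $i\notin\mathcal{M}^I$, $y_j=0$ for $j\notin\mathcal{M}^L$, $z_k=0$ for $k\notin\mathcal{M}^P$, so as to minimize $$\sum_{i\in\mathcal{M}^I}c^I_ix_i+\sum_{j\in\mathcal{M}^L}c^L_jy_j+\sum_{k\in\mathcal{M}^P}c^P_kz_k$$ subject to the perfect protection constraint: there exists $g:I(x)\to E$ with $i\in g(i)$ for all $i\in I(x)$ such that the graph $(V\cup\{0\},\,L(y)\cup E_{P0}(z)\cup g(I(x)))$ is connected. Here $0$ is an additional node not in $V$, $I(x)=\{i\in V\mid x_i=1\}$, $L(y)=\{e\in E\mid y_e=1\}$, $P(z)=\{i\in V\mid z_i=1\text{ or there is }k\in V\text{ with }z_k=1,\ \{i,k\}\in E\}$, and $E_{P0}(z)=\{\{i,0\}\mid i\in P(z)\}$. *)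

(* Defs.v *)
From HB Require Import structures.
From mathcomp Require Import all_boot all_order all_algebra.

Set Implicit Arguments.
Unset Strict Implicit.
Unset Printing Implicit Defensive.

Import Order.TTheory GRing.Theory Num.Theory.

(** * Multi-tape Turing machines *)

Inductive move := MoveLeft | Stay | MoveRight.

Definition code_move (m : move) : option bool :=
  match m with MoveLeft => Some false | Stay => None | MoveRight => Some true end.
Definition decode_move (o : option bool) : move :=
  match o with
  | Some false => MoveLeft | None => Stay | Some true => MoveRight
  end.
Fact code_moveK : cancel code_move decode_move. Proof. by case. Qed.
HB.instance Definition _ := Finite.copy move (can_type code_moveK).

(** Tape symbols: [None] is the blank, [Some (inl b)] is the input/output bit
    [b], and [Some (inr a)] is an auxiliary symbol of the machine. *)
Definition symbol (W : finType) : finType := option (bool + W)%type.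

(** A machine is nondeterministic in general: [trans] gives the set of actions
    (new state, symbols written, head moves) allowed by the current state and
    the scanned symbols.  It halts when no action is allowed.  There are
    [last_tape.+1] tapes: the input is on tape [ord0], and the output, if any,
    on tape [ord_max]. *)
Record machine := Machine {
  last_tape : nat;
  state : finType;
  work : finType;
  start : state;
  accepting : {set state};
  trans : state -> {ffun 'I_last_tape.+1 -> symbol work} ->
    {set state * {ffun 'I_last_tape.+1 -> symbol work}
               * {ffun 'I_last_tape.+1 -> move}}
}.

Definition deterministic (M : machine) : Prop :=
  forall (q : state M) (s : {ffun 'I_(last_tape M).+1 -> symbol (work M)}),
    #|trans q s| <= 1.

Section Runs.
Variable M : machine.

Definition action : finType :=
  (state M * {ffun 'I_(last_tape M).+1 -> symbol (work M)}
           * {ffun 'I_(last_tape M).+1 -> move})%type.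

(** Tapes are infinite to the right only, with cells numbered from 0. *)
Record config := Config {
  cstate : state M;
  head : 'I_(last_tape M).+1 -> nat;
  cell : 'I_(last_tape M).+1 -> nat -> symbol (work M)
}.

Definition tape_of (w : seq bool) (p : nat) : symbol (work M) :=
  nth None [seq Some (inl b) | b <- w] p.

Definition init (w : seq bool) : config :=
  Config (start M) (fun=> 0) (fun i => tape_of (if i == ord0 then w else [::])).

Definition enabled (c : config) : {set action} :=
  trans (cstate c) [ffun i => cell c i (head c i)].

(** A left move on cell 0 leaves the head in place. *)
Definition shift (m : move) (p : nat) : nat :=
  match m with MoveLeft => p.-1 | Stay => p | MoveRight => p.+1 end.

Definition act (a : action) (c : config) : config :=
  Config a.1.1
    (fun i => shift (a.2 i) (head c i))
    (fun i p => if p == head c i then a.1.2 i else cell c i p).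

Inductive reaches : nat -> config -> config -> Prop :=
| reaches0 c : reaches 0 c c
| reachesS t c a c' :
    a \in enabled c -> reaches t (act a c) c' -> reaches t.+1 c c'.

Definition accepts_in (t : nat) (w : seq bool) : Prop :=
  exists c, reaches t (init w) c /\ cstate c \in accepting M.

Definition outputs_in (t : nat) (w v : seq bool) : Prop :=
  exists c, [/\ reaches t (init w) c, enabled c = set0
              & forall p, cell c ord_max p = tape_of v p].

End Runs.

(** * NP and NP-hardness *)

Definition language := seq bool -> Prop.

Definition polynomial_bound (T : nat -> nat) : Prop :=
  exists a d : nat, forall n, T n <= a * n ^ d + a.

Definition in_NP (L : language) : Prop :=
  exists (M : machine) (T : nat -> nat),
    [/\ polynomial_bound T,
        forall w, L w <-> exists t, accepts_in M t w
      & forall w, L w -> exists2 t, t <= T (size w) & accepts_in M t w].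

Definition polytime_computable (f : seq bool -> seq bool) : Prop :=
  exists (M : machine) (T : nat -> nat),
    [/\ deterministic M, polynomial_bound T
      & forall w, exists2 t, t <= T (size w) & outputs_in M t w (f w)].

Definition polytime_reducible (A B : language) : Prop :=
  exists f, polytime_computable f /\ forall w, A w <-> B (f w).

Definition NP_hard (L : language) : Prop :=
  forall A, in_NP A -> polytime_reducible A L.

(** * Binary encodings *)

(** All the encodings below are prefix-free, hence can be concatenated. *)

Definition encode_seq (T : Type) (enc : T -> seq bool) (s : seq T) : seq bool :=
  flatten [seq true :: enc x | x <- s] ++ [:: false].

Definition encode_option (T : Type) (enc : T -> seq bool) (o : option T) :=
  if o is Some x then true :: enc x else [:: false].

(** The binary digits of [n], least significant first, without superfluous
    zeros ([up_log 2 n.+1] is the number of digits). *)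
Definition binary (n : nat) : seq bool :=
  [seq odd (n %/ 2 ^ i) | i <- iota 0 (up_log 2 n.+1)].

Definition encode_nat (n : nat) : seq bool :=
  encode_seq (fun b => [:: b]) (binary n).

Definition encode_rat (r : rat) : seq bool :=
  (numq r < 0)%R :: encode_nat `|numq r| ++ encode_nat `|denq r|.

(** * Minimization problems *)

Record min_problem := MinProblem {
  instance : Type;
  encode_instance : instance -> seq bool;
  solution : instance -> Type;
  feasible : forall I, solution I -> Prop;
  cost : forall I, solution I -> rat
}.

(** The decision version: given an instance and a rational number [K], is there
    a feasible solution of cost at most [K]? *)
Definition decision_version (P : min_problem) : language :=
  fun w => exists (I : instance P) (K : rat),
    w = encode_rat K ++ encode_instance I
    /\ exists s : solution I, feasible s /\ (cost s <= K)%R.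

Definition NP_hard_min_problem (P : min_problem) : Prop :=
  NP_hard (decision_version P).

(** * The perfect protection problem *)

(** The graph with vertex type [T] and edge set [F] is connected. *)
Definition graph_connected (T : finType) (F : {set {set T}}) : Prop :=
  0 < #|T| /\ forall u v : T, connect (fun a b => [set a; b] \in F) u v.

Record protection_instance (V : finType) := ProtectionInstance {
  edges : {set {set V}};
  edges_card2 : forall e, e \in edges -> #|e| = 2;
  edges_connected : graph_connected edges;
  MI : {set V};
  ML : {set {set V}};
  MP : {set V};
  ML_edges : ML \subset edges;
  (* Only the values on [MI], [ML] and [MP] respectively are relevant. *)
  cI : V -> rat;
  cL : {set V} -> rat;
  cP : V -> rat
}.

Section PerfectProtection.
Variables (V : finType) (N : protection_instance V).

(** The variables y are indexed by all the subsets of [V]; [support_feasible]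
    forces them to vanish outside [ML], hence outside [edges]. *)
Record protection := Protection {
  xvar : {ffun V -> bool};
  yvar : {ffun {set V} -> bool};
  zvar : {ffun V -> bool}
}.

Variable s : protection.

Definition nodesI : {set V} := [set i | xvar s i].

Definition edgesL : {set {set V}} := [set e in edges N | yvar s e].

Definition nodesP : {set V} :=
  [set i | zvar s i || [exists k, zvar s k && ([set i; k] \in edges N)]].

(** The additional node 0 is [None : option V]. *)
Definition edgesP0 : {set {set option V}} :=
  [set [set Some i; None] | i in nodesP].

Definition lift_edge (e : {set V}) : {set option V} := Some @: e.

Definition perfect_protection : Prop :=
  exists g : V -> {set V},
    (forall i, i \in nodesI -> g i \in edges N /\ i \in g i)
    /\ graph_connected
         ((lift_edge @: edgesL) :|: edgesP0
            :|: [set lift_edge (g i) | i in nodesI]).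

Definition support_feasible : Prop :=
  [/\ forall i, i \notin MI N -> xvar s i = false,
      forall e, e \notin ML N -> yvar s e = false
    & forall k, k \notin MP N -> zvar s k = false].

Definition protection_cost : rat :=
  (\sum_(i in MI N) cI N i * (xvar s i)%:R
   + \sum_(e in ML N) cL N e * (yvar s e)%:R
   + \sum_(k in MP N) cP N k * (zvar s k)%:R)%R.

End PerfectProtection.

Definition finite_protection_instance := {n : nat & protection_instance 'I_n}.

Section Encoding.
Variables (n : nat) (N : protection_instance 'I_n).

Definition encode_node (i : 'I_n) : seq bool :=
  encode_option encode_rat (if i \in MI N then Some (cI N i) else None)
  ++ encode_option encode_rat (if i \in MP N then Some (cP N i) else None).

Definition encode_pair (i j : 'I_n) : seq bool :=
  let e := [set i; j] in
  if e \in edges N then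
    true :: encode_option encode_rat (if e \in ML N then Some (cL N e) else None)
  else [:: false].

(** The list of nodes with their costs (which also determines [n]), followed by
    the adjacency matrix, restricted to [i < j], with the costs of the edges. *)
Definition encode_protection : seq bool :=
  encode_seq encode_node (enum 'I_n)
  ++ flatten [seq encode_pair i j | i : 'I_n <- enum 'I_n,
                                    j : 'I_n <- [seq j : 'I_n <- enum 'I_n | i < j]].

End Encoding.

Definition perfect_protection_problem : min_problem := {|
  instance := finite_protection_instance;
  encode_instance := fun I => encode_protection (projT2 I);
  solution := fun I => protection 'I_(projT1 I);
  feasible := fun I s =>
    support_feasible (projT2 I) s /\ perfect_protection (projT2 I) s;
  cost := fun I s => protection_cost (projT2 I) s
|}.

(* Main.v *)
From HB Require Import structures.
From mathcomp Require Import all_boot all_order all_algebra.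
From Stdlib Require Import FunctionalExtensionality.
Require Import Defs.
From mathcomp Require Import zify.

Set Implicit Arguments.
Unset Strict Implicit.
Unset Printing Implicit Defensive.

Import Order.TTheory GRing.Theory Num.Theory.

(** The minimum is NP-hard to find already when neither links nor node
    indicators may be chosen.  If [MI] and [ML] are empty then the only edges
    available join protected nodes to the extra node 0, so that a choice [z] is
    feasible exactly when it is a dominating set contained in [MP]
    ([domination_protection]): the problem contains weighted dominating set on
    connected graphs.  The whole reduction from an arbitrary language of NP is
    carried out with this special case, in three stages.

    Tilings.  The space-time diagram of a nondeterministic machine, drawn on a
    [B] by [B] square, is a tiling subject to a condition on each cell and a
    condition that relates a cell and its two horizontal neighbours to the cell
    of the next row.  Each tile carries, besides the contents of its cell, the
    action performed in its row, which is forced to be constant along the row;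
    this is how heads that stand far apart are synchronized.  An accepting state
    may idle, so that a run of any length less than [B] fills the square
    ([tiling_of_accepts], [accepts_of_tiling]).

    Graph.  A vertex is a position together with a kind: a [Tile] that may be
    placed there, a [Cell] that demands some admissible tile, or a [Rule] that
    stands for the clause -- left is not [l], or here is not [g], or right is
    not [r], or the tile of the next row is compatible with them.  Cells and
    rules are adjacent to the tiles that satisfy them and cannot be chosen, so
    domination says that all the conditions hold, provided that no position
    receives two tiles.  This is enforced by the prices: a tile costs 1, and a
    [Bonus] vertex at each position costs -1.  A total price of at most 0 hence
    allows no more than one tile per position on average, while every cell needs
    one ([cover_dominates], [tiling_of_dominating]).  The prices are constants
    and the budget is 0, so that no number that depends on the input is ever
    written in binary.

    Computation.  The code of the instance is printed by nested loops over the
    coordinates of two vertices, each bit of the adjacency matrix being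
    determined by which coordinates are equal, consecutive, or extreme.
    This is done by a deterministic machine whose tapes serve as counters: the
    value of a counter is the position of its head.  The machine also keeps the
    differences between the coordinates on tapes of their own, so that all that
    the printed bit depends on is scanned at once ([computes_printer]).

    A last point is that the decision problem speaks of any instance with a
    given code; codes are prefix-free and determine all the data that matter
    ([encode_protection_transfer]). *)

(** * Structured programs for deterministic machines *)

Section Fragments.
Variables (nt : nat) (W : finType).

Notation scan := {ffun 'I_nt.+1 -> symbol W}.
Notation moves := {ffun 'I_nt.+1 -> move}.

(** A piece of a deterministic machine, entered at [entry] and left when [code]
    returns no next label.  The exit is an instruction like the others: it
    writes and moves, so that composition in sequence takes no extra step. *)
Record fragment := Fragment {
  label : finType;
  entry : label;
  code : label -> scan -> option label * scan * moves
}.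

Definition tapes : Type := ('I_nt.+1 -> nat) * ('I_nt.+1 -> nat -> symbol W).

Definition scanned (T : tapes) : scan := [ffun i => T.2 i (T.1 i)].

Definition update (s : scan) (m : moves) (T : tapes) : tapes :=
  (fun i => shift (m i) (T.1 i), fun i p => if p == T.1 i then s i else T.2 i p).

Inductive run (F : fragment) : nat -> label F -> tapes -> tapes -> Prop :=
| run_exit l T s m :
    code l (scanned T) = (None, s, m) -> run 1 l T (update s m T)
| run_next t l T l' s m T' :
    code l (scanned T) = (Some l', s, m) -> run t l' (update s m T) T' ->
    run t.+1 l T T'.

(** From [T], the fragment [F] reaches its exit with tapes [T'] in at most [b]
    steps. *)
Definition computes (F : fragment) (b : nat) (T T' : tapes) : Prop :=
  exists2 t, t <= b & run t (entry F) T T'.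

Lemma computes_le F b b' T T' : b <= b' -> computes F b T T' -> computes F b' T T'.
Proof. by move=> le [t tb r]; exists t => //; apply: leq_trans le. Qed.

Definition stay : moves := [ffun=> Stay].

Lemma update_stay T : update (scanned T) stay T = T.
Proof.
case: T => h c; congr pair; apply: functional_extensionality => i.
  by rewrite ffunE.
by apply: functional_extensionality => p; rewrite ffunE; case: eqP => // ->.
Qed.

Definition atomic (f : scan -> scan * moves) : fragment :=
  @Fragment unit tt (fun _ s => (None, (f s).1, (f s).2)).

Lemma computes_atomic f T : computes (atomic f) 1 T (update (f (scanned T)).1 (f (scanned T)).2 T).
Proof. by exists 1 => //; apply: run_exit. Qed.

Definition seqf (A B : fragment) : fragment :=
  @Fragment (label A + label B)%type (inl (entry A)) (fun l s =>
    match l with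
    | inl a => let: (o, s', m) := code a s in
               (Some (if o is Some a' then inl a' else inr (entry B)), s', m)
    | inr b => let: (o, s', m) := code b s in (omap inr o, s', m)
    end).

Lemma computes_seq A B b b' T T' T'' :
  computes A b T T' -> computes B b' T' T'' -> computes (seqf A B) (b + b') T T''.
Proof.
case=> t tb rA [t' tb' rB]; exists (t + t'); first exact: leq_add.
have {}rB : run (F := seqf A B) t' (inr (entry B)) T' T''.
  move: (entry B) rB => l; elim=> [l1 U s m e|t1 l1 U l2 s m U' e _ IH].
    by apply: run_exit => /=; rewrite e.
  by apply: run_next IH => /=; rewrite e.
rewrite /=; elim: rA rB => {tb} [l1 U s m e|t1 l1 U l2 s m U' e _ IH] rB.
  by rewrite add1n; apply: run_next rB; rewrite /= e.
by rewrite addSn; apply: run_next (IH rB); rewrite /= e.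
Qed.

Definition while (c : scan -> bool) (A : fragment) : fragment :=
  @Fragment (option (label A)) None (fun l s =>
    if l is Some a then let: (o, s', m) := code a s in (Some o, s', m)
    else ((if c s then Some (Some (entry A)) else None), s, stay)).

(** The states of the tapes before each iteration are given in advance, as a
    sequence [T] of known length [n]; every loop below is of this kind, which
    makes the time bound immediate. *)
Lemma computes_while (c : scan -> bool) A b n (T : nat -> tapes) :
  (forall j, j < n -> c (scanned (T j))) -> ~~ c (scanned (T n)) ->
  (forall j, j < n -> computes A b (T j) (T j.+1)) ->
  computes (while c A) (n * b.+1).+1 (T 0) (T n).
Proof.
elim: n T => [|n IH] T cT cn stepT.
  exists 1 => //; rewrite -[T 0 in X in run _ _ _ X]update_stay.
  by apply: run_exit; rewrite /= (negbTE cn).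
have [||t' tb' r'] := IH (fun j => T j.+1) _ cn.
- by move=> j jn; apply: cT.
- by move=> j jn; apply: stepT.
have [t tb r] := stepT 0 isT.
exists (t + t').+1; first by rewrite mulSn; lia.
apply: (@run_next (while c A) _ None _ (Some (entry A)) (scanned (T 0)) stay) => /=.
  by rewrite cT.
rewrite update_stay; move: r r'; rewrite /=.
elim=> {tb} [l1 U s m e|t1 l1 U l2 s m U' e _ IHr] r'.
  by rewrite add1n; apply: run_next r'; rewrite /= e.
by rewrite addSn; apply: run_next (IHr r'); rewrite /= e.
Qed.

Definition seqfs (Fs : seq fragment) : fragment :=
  foldr seqf (atomic (fun s => (s, stay))) Fs.

Lemma computes_seqfs_nil T : computes (seqfs [::]) 1 T T.
Proof.
have := computes_atomic (fun s => (s, stay)) T; rewrite /= update_stay; exact.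
Qed.

Definition machine_of (F : fragment) : machine :=
  @Machine nt (option (label F)) W (Some (entry F)) set0
    (fun q s => if q is Some l then [set code l s] else set0).

Lemma machine_of_deterministic F : deterministic (machine_of F).
Proof. by move=> [l|] s /=; rewrite ?cards1 ?cards0. Qed.

Lemma machine_of_run F t l T T' : run t l T T' ->
  @reaches (machine_of F) t (@Config (machine_of F) (Some l) T.1 T.2)
    (@Config (machine_of F) None T'.1 T'.2).
Proof.
elim=> {t l T T'} [l T s m e|t l T l' s m T' e _ IH].
  apply: (@reachesS (machine_of F) _ _ (None, s, m)); last exact: reaches0.
  by rewrite /enabled /= in_set1 -/(scanned T) e.
apply: (@reachesS (machine_of F) _ _ (Some l', s, m)); last exact: IH.
by rewrite /enabled /= in_set1 -/(scanned T) e.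
Qed.

Definition bits_tape (w : seq bool) (p : nat) : symbol W :=
  nth None [seq Some (inl b) | b <- w] p.

Definition start_tapes (w : seq bool) : tapes :=
  (fun=> 0, fun i => bits_tape (if i == ord0 then w else [::])).

(** The final label of [machine_of] allows no action, so that leaving the
    fragment is halting. *)
Lemma polytime_of_fragment (F : fragment) (b : nat -> nat) (f : seq bool -> seq bool) :
  polynomial_bound b ->
  (forall w, exists T, computes F (b (size w)) (start_tapes w) T
     /\ T.2 ord_max = bits_tape (f w)) ->
  polytime_computable f.
Proof.
move=> pb H; exists (machine_of F), b; split=> //.
  exact: machine_of_deterministic.
move=> w; have [T [[t tb r] out]] := H w; exists t => //.
exists (@Config (machine_of F) None T.1 T.2); split.
- exact: machine_of_run r.
- by [].
- by move=> p /=; rewrite out.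
Qed.

End Fragments.

(** * Counters held by heads *)

Notation csymbol := (symbol bool).
Notation cscan := {ffun 'I_18 -> csymbol}.
Notation cfragment := (fragment 17 bool).

(** Cells 0 and 1 of a counter tape are marked and its other cells are blank.
    The counter has the position of the head as its value, so that scanning
    tells whether it is 0, 1, or more. *)
Definition ruler (p : nat) : csymbol :=
  match p with 0 => Some (inr true) | 1 => Some (inr false) | _ => None end.

(** Tape 0 holds the input [w], the last tape holds the printed word [out] with
    its head just after it, and the 16 tapes in between are counters; [h] gives
    the positions of all the heads but the last. *)
Definition counters (w : seq bool) (h : nat -> nat) (out : seq bool) : tapes 17 bool :=
  (fun i => if i == ord_max then size out else h i,
   fun i p => if i == ord0 then bits_tape bool w p
              else if i == ord_max then bits_tape bool out p else ruler p).

Definition at_reg (s : cscan) (i : nat) : csymbol := s (inord i).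
Definition zero s i := at_reg s i == Some (inr true).
Definition one s i := at_reg s i == Some (inr false).

Lemma bits_tape_size W w : bits_tape W w (size w) = None.
Proof. by rewrite /bits_tape nth_default // size_map. Qed.

Lemma scanned_counters w h out :
  scanned (counters w h out) =
  [ffun i : 'I_18 => if i == ord0 then bits_tape bool w (h 0)
            else if i == ord_max then None else ruler (h i)].
Proof.
apply/ffunP=> i; rewrite !ffunE /=.
case: (eqVneq i ord0) => [-> //|_].
by case: (eqVneq i ord_max) => // _; rewrite bits_tape_size.
Qed.

Lemma at_reg_counters w h out i : 0 < i < 17 ->
  at_reg (scanned (counters w h out)) i = ruler (h i).
Proof.
case/andP=> i0 i17; rewrite /at_reg scanned_counters ffunE -!val_eqE /= inordK; last by lia.
by rewrite !ifN //; lia.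
Qed.

Lemma at_reg_input w h out :
  at_reg (scanned (counters w h out)) 0 = bits_tape bool w (h 0).
Proof. by rewrite /at_reg scanned_counters ffunE -!val_eqE /= inordK. Qed.

Lemma zero_counters w h out i : 0 < i < 17 ->
  zero (scanned (counters w h out)) i = (h i == 0).
Proof. by move=> hi; rewrite /zero at_reg_counters //; case: (h i) => [|[]]. Qed.

Lemma one_counters w h out i : 0 < i < 17 ->
  one (scanned (counters w h out)) i = (h i == 1).
Proof. by move=> hi; rewrite /one at_reg_counters //; case: (h i) => [|[]]. Qed.

Definition stepf (mv : cscan -> nat -> move) : cfragment :=
  atomic (fun s => (s, [ffun i : 'I_18 => if i == ord_max then Stay else mv s i])).

Lemma computes_step mv w h h' out :
  (forall i, i < 17 -> shift (mv (scanned (counters w h out)) i) (h i) = h' i) ->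
  computes (stepf mv) 1 (counters w h out) (counters w h' out).
Proof.
move=> H; have := computes_atomic (fun s => (s, [ffun i : 'I_18 => if i == ord_max then Stay else mv s i])) (counters w h out).
congr computes; congr pair; apply: functional_extensionality => i /=.
  rewrite ffunE; case: (eqVneq i ord_max) => // im; apply: H.
  have := ltn_ord i; move: im; rewrite -val_eqE /=; lia.
apply: functional_extensionality => p; rewrite ffunE /=.
by case: eqP => // ->.
Qed.

Definition mvl (incs decs : seq nat) (i : nat) : move :=
  if i \in incs then MoveRight else if i \in decs then MoveLeft else Stay.

(** Printing [v] and restoring all the counters, whatever has been printed
    before. *)
Definition prints (F : cfragment) (b : nat) w h (v : seq bool) :=
  forall out, computes F b (counters w h out) (counters w h (out ++ v)).

Lemma prints_seq A B a b w h u v : prints A a w h u -> prints B b w h v ->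
  prints (seqf A B) (a + b) w h (u ++ v).
Proof.
move=> pA pB out; apply: computes_seq (pA out) _.
by rewrite catA; apply: pB.
Qed.

Lemma prints_seqfs (I : eqType) (s : seq I) F b w h (g : I -> seq bool) :
  {in s, forall i, prints (F i) b w h (g i)} ->
  prints (seqfs [seq F i | i <- s]) (size s * b + 1) w h (flatten [seq g i | i <- s]).
Proof.
elim: s => [|i s IH] H.
  rewrite /prints => out. rewrite /= cats0 mul0n add0n.
  exact: computes_seqfs_nil.
rewrite /= mulSn -addnA; apply: prints_seq; first by apply: H; rewrite mem_head.
by apply: IH => j js; apply: H; rewrite inE js orbT.
Qed.

Definition write (g : cscan -> option bool) : cfragment :=
  atomic (fun s => ([ffun i => if i == ord_max then omap inl (g s) else s i],
                [ffun i => if (i == ord_max) && (g s != None) then MoveRight else Stay])).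

Lemma scanned_counters_out w h out out' :
  scanned (counters w h out) = scanned (counters w h out').
Proof. by rewrite !scanned_counters. Qed.

Lemma prints_write g w h :
  prints (write g) 1 w h (seq_of_opt (g (scanned (counters w h [::])))).
Proof.
move=> out; have := computes_atomic (fun s => ([ffun i => if i == ord_max then omap inl (g s) else s i],
                [ffun i => if (i == ord_max) && (g s != None) then MoveRight else Stay])) (counters w h out).
congr computes; congr pair; rewrite (scanned_counters_out w h out [::]) /=;
  set s := scanned _; apply: functional_extensionality => i /=.
  rewrite ffunE; case: (eqVneq i ord_max) => //= _.
  by case: (g s) => [b|] /=; rewrite ?cats0 // cats1 size_rcons.
apply: functional_extensionality => p; rewrite ffunE /=.
case: (eqVneq i ord_max) => [->|im] /=; last first.
  rewrite /s scanned_counters ffunE (negbTE im).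
  by case: (eqVneq i ord0) => [->|_]; case: (p =P _) => // ->.
rewrite /bits_tape; case: (g s) => [b|] /=; last first.
  rewrite cats0; case: eqP => // ->; apply/esym/nth_default; by rewrite size_map.
rewrite cats1 map_rcons nth_rcons size_map.
case: ltngtP => // lt; by rewrite nth_default ?size_map // ltnW.
Qed.

(** What is scanned does not change while a word is printed, as the head of the
    output tape stays on blanks.  The word [g s] can thus be printed letter by
    letter, each letter being recomputed from the current scan. *)
Definition emit (g : cscan -> seq bool) : cfragment :=
  seqfs [seq write (fun s => onth (g s) i) | i <- iota 0 (\max_s size (g s))].

Lemma flatten_onth (T : Type) (v : seq T) n : size v <= n ->
  flatten [seq seq_of_opt (onth v i) | i <- iota 0 n] = v.
Proof.
elim: v n => [|x v IH] n /= vn.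
  by elim: (iota 0 n) => //= i s ->; case: i.
case: n vn => // n vn /=; congr cons.
by rewrite -[RHS](IH n vn) -(addn0 1) iotaDl -map_comp.
Qed.

Lemma prints_emit g w h :
  prints (emit g) (\max_s size (g s) + 1) w h (g (scanned (counters w h [::]))).
Proof.
set s := scanned _.
have gs : size (g s) <= \max_s size (g s) by exact: (leq_bigmax s).
rewrite -[X in prints _ _ _ _ X](flatten_onth gs) -[X in X + 1](size_iota 0) -[X in X + 1]muln1.
by apply: prints_seqfs => i _; apply: prints_write.
Qed.

(** The counters during the main computation.  The loop variables are [e 0],
    [e 1], [e 2], [e 3]: the row and column of a vertex, then of another one.
    Each variable comes with its distance to the bound [B], which controls the
    loop, and the two truncated differences of the rows, and of the columns, are
    kept as well.  The input head follows [e 1]; [c] is left over from the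
    computation of [B]. *)
Definition regs (c B : nat) (e : nat -> nat) : nat -> nat := nth 0
  [:: e 1; e 0; B - e 0; e 1; B - e 1; e 2; B - e 2; e 3; B - e 3;
      e 2 - e 0; e 0 - e 2; e 3 - e 1; e 1 - e 3; 0; c; 0; 0].

Definition upd (e : nat -> nat) v j : nat -> nat := fun u => if u == v then j else e u.

(** Which of the two truncated differences has to change can be read off from
    whether one of them is zero, so that incrementing a variable together with
    all that depends on it takes a single step. *)
Definition inc_moves (v : nat) (s : cscan) : nat -> move :=
  match v with
  | 0 => if zero s 9 then mvl [:: 1; 10] [:: 2] else mvl [:: 1] [:: 2; 9]
  | 1 => if zero s 11 then mvl [:: 0; 3; 12] [:: 4] else mvl [:: 0; 3] [:: 4; 11]
  | 2 => if zero s 10 then mvl [:: 5; 9] [:: 6] else mvl [:: 5] [:: 6; 10]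
  | _ => if zero s 12 then mvl [:: 7; 11] [:: 8] else mvl [:: 7] [:: 8; 12]
  end.

Definition dec_moves (v : nat) (s : cscan) : nat -> move :=
  match v with
  | 0 => if zero s 10 then mvl [:: 2; 9] [:: 1] else mvl [:: 2] [:: 1; 10]
  | 1 => if zero s 12 then mvl [:: 4; 11] [:: 0; 3] else mvl [:: 4] [:: 0; 3; 12]
  | 2 => if zero s 9 then mvl [:: 6; 10] [:: 5] else mvl [:: 6] [:: 5; 9]
  | _ => if zero s 11 then mvl [:: 8; 12] [:: 7] else mvl [:: 8] [:: 7; 11]
  end.

Lemma computes_inc c B v e w out : v < 4 -> e v < B ->
  computes (stepf (inc_moves v)) 1 (counters w (regs c B e) out)
    (counters w (regs c B (upd e v (e v).+1)) out).
Proof.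
move=> v4 evB; apply: computes_step => i i17.
case: v v4 evB => [|[|[|[|//]]]] _ evB; rewrite /inc_moves zero_counters //=;
case: ifP => /eqP; rewrite /regs /upd /=;
do 17 (case: i i17 => [|i] i17 //=; try lia).
Qed.

Lemma computes_dec c B v e w out : v < 4 -> e v < B ->
  computes (stepf (dec_moves v)) 1 (counters w (regs c B (upd e v (e v).+1)) out)
    (counters w (regs c B e) out).
Proof.
move=> v4 evB; apply: computes_step => i i17.
case: v v4 evB => [|[|[|[|//]]]] _ evB; rewrite /dec_moves zero_counters //=;
case: ifP => /eqP; rewrite /regs /upd /=;
do 17 (case: i i17 => [|i] i17 //=; try lia).
Qed.

Definition value_reg v := v.*2.+1.
Definition rest_reg v := v.*2.+2.

(** The second loop brings the variable back to 0. *)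
Definition for_ (v : nat) (body : cfragment) : cfragment :=
  seqf (while (fun s => ~~ zero s (rest_reg v)) (seqf body (stepf (inc_moves v))))
       (while (fun s => ~~ zero s (value_reg v)) (stepf (dec_moves v))).

Definition for_time (B b : nat) := (B * (b + 1).+1).+1 + (B * 2).+1.

Lemma value_regE c B e v : v < 4 -> regs c B e (value_reg v) = e v.
Proof. by case: v => [|[|[|[|]]]]. Qed.
Lemma rest_regE c B e v : v < 4 -> regs c B e (rest_reg v) = B - e v.
Proof. by case: v => [|[|[|[|]]]]. Qed.

Lemma upd_id e v : upd e v (e v) = e.
Proof. by apply: functional_extensionality => u; rewrite /upd; case: eqP => [->|]. Qed.
Lemma upd_upd e v i j : upd (upd e v i) v j = upd e v j.
Proof. by apply: functional_extensionality => u; rewrite /upd; case: eqP. Qed.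
Lemma upd_eq e v j : upd e v j v = j.
Proof. by rewrite /upd eqxx. Qed.

Lemma prints_for c B b w e v body (g : nat -> seq bool) : v < 4 -> e v = 0 ->
  (forall j, j < B -> prints body b w (regs c B (upd e v j)) (g j)) ->
  prints (for_ v body) (for_time B b) w (regs c B e) (flatten [seq g j | j <- iota 0 B]).
Proof.
move=> v4 ev0 H out.
pose T j := counters w (regs c B (upd e v j)) (out ++ flatten [seq g i | i <- iota 0 j]).
have e0 : upd e v 0 = e by rewrite -[RHS](upd_id e v) ev0.
have eT : counters w (regs c B e) out = T 0 by rewrite /T /= cats0 e0.
have vr : 0 < value_reg v < 17 by rewrite /value_reg; lia.
have rr : 0 < rest_reg v < 17 by rewrite /rest_reg; lia.
rewrite eT; apply: (@computes_seq _ _ _ _ _ _ _ (T B)).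
  apply: computes_while.
  - by move=> j jB; rewrite zero_counters // rest_regE // upd_eq; lia.
  - by rewrite zero_counters // rest_regE // upd_eq subnn.
  move=> j jB; apply: computes_seq (H j jB _) _.
  rewrite -catA (_ : flatten _ ++ g j = flatten [seq g i | i <- iota 0 j.+1]); last first.
    by rewrite -addn1 iotaD map_cat flatten_cat /= cats0.
  have eS : upd e v j.+1 = upd (upd e v j) v (upd e v j v).+1 by rewrite upd_upd upd_eq.
  rewrite /T eS.
  by apply: computes_inc; rewrite // upd_eq.
rewrite /T; set out' := out ++ _.
have -> : regs c B (upd e v B) = regs c B (upd e v (B - 0)) by rewrite subn0.
have -> : regs c B e = regs c B (upd e v (B - B)) by rewrite subnn e0.
apply: (@computes_while _ _ _ _ _ _ (fun j => counters w (regs c B (upd e v (B - j))) out')).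
- by move=> j jB; rewrite zero_counters // value_regE // upd_eq; lia.
- by rewrite zero_counters // value_regE // upd_eq subnn.
move=> j jB.
have -> : upd e v (B - j) = upd (upd e v (B - j.+1)) v (upd e v (B - j.+1) v).+1.
  by rewrite upd_upd upd_eq; congr upd; lia.
by apply: computes_dec; rewrite // upd_eq; lia.
Qed.

(** * Computing a polynomial bound on the loops *)

(** All the counters are stamped at cells 0 and 1 in two steps, the second of
    which brings their heads back to 0. *)
Definition is_counter (i : 'I_18) := (i != ord0) && (i != ord_max).

Definition stamp (b : bool) (mv : move) (s : cscan) :
    cscan * {ffun 'I_18 -> move} :=
  ([ffun i => if is_counter i then Some (inr b) else s i],
   [ffun i => if is_counter i then mv else Stay]).

Definition draw_rulers : cfragment :=
  seqf (atomic (stamp true MoveRight)) (atomic (stamp false MoveLeft)).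

Lemma computes_draw_rulers w :
  computes draw_rulers 2 (start_tapes 17 bool w) (counters w (fun=> 0) [::]).
Proof.
have := computes_seq (computes_atomic (stamp true MoveRight) (start_tapes 17 bool w))
          (computes_atomic (stamp false MoveLeft) _).
congr computes; congr pair; apply: functional_extensionality => i;
  rewrite /stamp /update /is_counter /=.
  by rewrite !ffunE /= if_same; case: ifP.
apply: functional_extensionality => p; rewrite /scanned !ffunE /= !ffunE /=.
case: (eqVneq i ord0) => [->|i0] /=; first by rewrite ?ffunE; case: p.
case: (eqVneq i ord_max) => im /=; first by rewrite ?ffunE; case: p.
by case: p => [|[|p]] //=; rewrite /bits_tape nth_default.
Qed.

(** The counters while the bound is computed: [x] is the position of the input
    head, [b] the common value of the four counters that bound the loops, and
    [m], [m2], [acc], [acc2] are scratch. *)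
Definition ctl x b m m2 acc acc2 : nat -> nat :=
  nth 0 [:: x; 0; b; 0; b; 0; b; 0; b; 0; 0; 0; 0; m; m2; acc; acc2].

Lemma regs0 c B : regs c B (fun=> 0) = ctl 0 B 0 c 0 0.
Proof. by rewrite /regs !subn0. Qed.

Lemma ctl0 : (fun=> 0) = ctl 0 0 0 0 0 0.
Proof. apply: functional_extensionality => i; do 17 (case: i => [//|i]).
by rewrite /ctl /= nth_nil. Qed.

Definition bump (incs decs : seq nat) : cfragment := stepf (fun _ => mvl incs decs).
Definition until_zero r (F : cfragment) : cfragment := while (fun s => ~~ zero s r) F.

(* The effect of a step is checked on each of the 17 heads in turn. *)
Ltac bump_tac :=
  let i := fresh "i" in let i17 := fresh "i17" in
  apply: computes_step => i i17; rewrite /ctl /=;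
  do 17 (case: i i17 => [|i] i17 //=; try lia).

Section Setup.
Variables (w : seq bool) (out : seq bool).
Notation C := (fun h => counters w h out).

Lemma computes_until_zero r F b n (h : nat -> nat -> nat) : 0 < r < 17 ->
  (forall j, j <= n -> h j r = n - j) ->
  (forall j, j < n -> computes F b (C (h j)) (C (h j.+1))) ->
  computes (until_zero r F) (n * b.+1).+1 (C (h 0)) (C (h n)).
Proof.
move=> r17 hr H; apply: (@computes_while _ _ _ _ _ _ (fun j => C (h j))) => //.
- by move=> j jn; rewrite zero_counters // hr ?(ltnW jn) //; lia.
- by rewrite zero_counters // hr // subnn.
Qed.

Lemma computes_nseq n F b (T : nat -> tapes 17 bool) :
  (forall j, j < n -> computes F b (T j) (T j.+1)) ->
  computes (seqfs (nseq n F)) (n * b + 1) (T 0) (T n).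
Proof.
elim: n T => [|n IH] T H /=; first exact: computes_seqfs_nil.
rewrite mulSn -addnA; apply: computes_seq (H 0 isT) _.
by apply: (IH (fun j => T j.+1)) => j jn; apply: H.
Qed.

Lemma bits_tape_none p : (bits_tape bool w p == None) = (size w <= p).
Proof.
rewrite /bits_tape; case: (leqP (size w) p) => h.
  by rewrite nth_default ?size_map.
by rewrite (nth_map false).
Qed.

(** The counter that measures the input also serves to rewind its head, as the
    cell 0 of the input tape bears no mark. *)
Definition measure_input : cfragment :=
  seqf (while (fun s => at_reg s 0 != None) (bump [:: 0; 13] [::]))
       (until_zero 13 (bump [:: 14] [:: 0; 13])).

Lemma computes_measure_input :
  computes measure_input ((size w * 2).+1 + (size w * 2).+1)
    (C (ctl 0 0 0 0 0 0)) (C (ctl 0 0 0 (size w) 0 0)).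
Proof.
apply: (@computes_seq _ _ _ _ _ _ _ (C (ctl (size w) 0 (size w) 0 0 0))).
  apply: (@computes_while _ _ _ _ _ _ (fun j => C (ctl j 0 j 0 0 0))).
  - by move=> j jn; rewrite at_reg_input bits_tape_none -ltnNge.
  - by rewrite at_reg_input bits_tape_none negbK /=.
  - by move=> j jn; bump_tac.
(* The endpoints are put in the form of the terms of the sequence of states
   that the loop goes through; likewise below. *)
have -> : ctl (size w) 0 (size w) 0 0 0 = ctl (size w - 0) 0 (size w - 0) 0 0 0 by rewrite subn0.
have -> : ctl 0 0 0 (size w) 0 0 = ctl (size w - size w) 0 (size w - size w) (size w) 0 0 by rewrite subnn.
apply: (@computes_until_zero _ _ _ _ (fun j => ctl (size w - j) 0 (size w - j) j 0 0)) => //.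
by move=> j jn; bump_tac.
Qed.

(** The accumulator 15 is multiplied by 14; the loops on 14 and 13 add 14 to 16
    and restore 14. *)
Definition multiply : cfragment :=
  seqf (until_zero 15
         (seqf (bump [::] [:: 15])
           (seqf (until_zero 14 (bump [:: 13; 16] [:: 14]))
                 (until_zero 13 (bump [:: 14] [:: 13])))))
       (until_zero 16 (bump [:: 15] [:: 16])).

Definition multiply_time A m := (A * (1 + ((m * 2).+1 + (m * 2).+1)).+1).+1 + (A * m * 2).+1.

Lemma computes_multiply m A :
  computes multiply (multiply_time A m) (C (ctl 0 0 0 m A 0)) (C (ctl 0 0 0 m (A * m) 0)).
Proof.
apply: (@computes_seq _ _ _ _ _ _ _ (C (ctl 0 0 0 m (A - A) (A * m)))).
  have -> : ctl 0 0 0 m A 0 = ctl 0 0 0 m (A - 0) (0 * m) by rewrite subn0.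
  apply: (@computes_until_zero _ _ _ _ (fun j => ctl 0 0 0 m (A - j) (j * m))) => //.
  move=> j jA; apply: (@computes_seq _ _ _ _ _ _ _ (C (ctl 0 0 0 m (A - j.+1) (j * m)))).
    by bump_tac.
  apply: (@computes_seq _ _ _ _ _ _ _ (C (ctl 0 0 m (m - m) (A - j.+1) (j * m + m)))).
    have -> : ctl 0 0 0 m (A - j.+1) (j * m) = ctl 0 0 0 (m - 0) (A - j.+1) (j * m + 0).
      by rewrite subn0 addn0.
    apply: (@computes_until_zero _ _ _ _ (fun i => ctl 0 0 i (m - i) (A - j.+1) (j * m + i))) => //.
    by move=> i im; bump_tac.
  have -> : ctl 0 0 m (m - m) (A - j.+1) (j * m + m) = ctl 0 0 (m - 0) 0 (A - j.+1) (j.+1 * m).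
    by rewrite subn0 subnn mulSnr.
  have -> : ctl 0 0 0 m (A - j.+1) (j.+1 * m) = ctl 0 0 (m - m) m (A - j.+1) (j.+1 * m).
    by rewrite subnn.
  apply: (@computes_until_zero _ _ _ _ (fun i => ctl 0 0 (m - i) i (A - j.+1) (j.+1 * m))) => //.
  by move=> i im; bump_tac.
have -> : ctl 0 0 0 m (A - A) (A * m) = ctl 0 0 0 m 0 (A * m - 0) by rewrite subn0 subnn.
have -> : ctl 0 0 0 m (A * m) 0 = ctl 0 0 0 m (A * m) (A * m - A * m) by rewrite subnn.
apply: (@computes_until_zero _ _ _ _ (fun i => ctl 0 0 0 m i (A * m - i))) => //.
by move=> i im; bump_tac.
Qed.

(** The bounds of all the loops are set to [(n + c) ^ D], where [n] is the size
    of the input. *)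
Definition set_bound (c D : nat) : cfragment :=
  seqf measure_input
    (seqf (seqfs (nseq c (bump [:: 14] [::])))
      (seqf (bump [:: 15] [::])
        (seqf (seqfs (nseq D multiply))
          (until_zero 15 (bump [:: 2; 4; 6; 8] [:: 15]))))).

Definition set_bound_time (c D n : nat) :=
  ((n * 2).+1 + (n * 2).+1) + ((c * 1 + 1) + (1 +
    ((D * multiply_time ((n + c) ^ D) (n + c) + 1) + ((n + c) ^ D * 2).+1))).

Lemma multiply_time_le A A' m : A <= A' -> multiply_time A m <= multiply_time A' m.
Proof. by move=> le; rewrite /multiply_time leq_add // ltnS leq_mul // leq_mul. Qed.

Lemma computes_set_bound c D : 0 < c ->
  computes (set_bound c D) (set_bound_time c D (size w)) (C (fun=> 0))
    (C (regs (size w + c) ((size w + c) ^ D) (fun=> 0))).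
Proof.
move=> c0; rewrite regs0 ctl0; set n := size w; set B := _ ^ D.
apply: computes_seq computes_measure_input _.
apply: (@computes_seq _ _ _ _ _ _ _ (C (ctl 0 0 0 (n + c) 0 0))).
  rewrite -[size w]addn0 -/n.
  apply: (@computes_nseq _ _ _ (fun j => C (ctl 0 0 0 (n + j) 0 0))).
  by move=> j jc; bump_tac.
apply: (@computes_seq _ _ _ _ _ _ _ (C (ctl 0 0 0 (n + c) ((n + c) ^ 0) 0))).
  by bump_tac.
apply: (@computes_seq _ _ _ _ _ _ _ (C (ctl 0 0 0 (n + c) B 0))).
  apply: (@computes_nseq _ _ _ (fun j => C (ctl 0 0 0 (n + c) ((n + c) ^ j) 0))).
  move=> j jD; rewrite expnSr; apply: computes_le (computes_multiply _ _).
  by apply: multiply_time_le; rewrite /B leq_pexp2l ?(ltnW jD) //; lia.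
have -> : ctl 0 0 0 (n + c) B 0 = ctl 0 0 0 (n + c) (B - 0) 0 by rewrite subn0.
have -> : ctl 0 B 0 (n + c) 0 0 = ctl 0 B 0 (n + c) (B - B) 0 by rewrite subnn.
apply: (@computes_until_zero _ _ _ _ (fun i => ctl 0 i 0 (n + c) (B - i) 0)) => //.
by move=> i iB; bump_tac.
Qed.

End Setup.

(** * Polynomial bounds *)

(** The powers of [n.+1] are more convenient than those of [n] for closure
    properties, since they are nonzero and increase with the exponent. *)
Lemma polynomial_boundP T : polynomial_bound T <-> exists c e, forall n, T n <= c * n.+1 ^ e.
Proof.
split=> [[a [d H]]|[c [e H]]].
  exists a.*2, d => n; apply: leq_trans (H n) _.
  have h1 : n ^ d <= n.+1 ^ d by case: d {H} => // d; rewrite leq_exp2r.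
  have h2 : 0 < n.+1 ^ d by rewrite expn_gt0.
  nia.
exists (c * 2 ^ e), e => n; apply: leq_trans (H n) _.
have e0 : 0 < 2 ^ e by rewrite expn_gt0.
case: n => [|n]; first by rewrite exp1n muln1; nia.
have : n.+2 ^ e <= (2 * n.+1) ^ e by case: (e) => // e'; rewrite leq_exp2r //; lia.
rewrite expnMn; nia.
Qed.

Lemma polynomial_bound_le T T' : (forall n, T n <= T' n) -> polynomial_bound T' -> polynomial_bound T.
Proof. by move=> le [a [d H]]; exists a, d => n; apply: leq_trans (H n). Qed.

Lemma polynomial_bound_const c : polynomial_bound (fun=> c).
Proof. by apply/polynomial_boundP; exists c, 0 => n; rewrite muln1. Qed.

Lemma polynomial_bound_id : polynomial_bound id.
Proof. by apply/polynomial_boundP; exists 1, 1 => n; rewrite mul1n expn1. Qed.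

Lemma polynomial_bound_add S T : polynomial_bound S -> polynomial_bound T ->
  polynomial_bound (fun n => S n + T n).
Proof.
move=> /polynomial_boundP[c [e H]] /polynomial_boundP[c' [e' H']].
apply/polynomial_boundP; exists (c + c'), (e + e') => n.
rewrite mulnDl leq_add //; first apply: leq_trans (H n) _.
  by rewrite leq_mul // leq_pexp2l // leq_addr.
by apply: leq_trans (H' n) _; rewrite leq_mul // leq_pexp2l // leq_addl.
Qed.

Lemma polynomial_bound_mul S T : polynomial_bound S -> polynomial_bound T ->
  polynomial_bound (fun n => S n * T n).
Proof.
move=> /polynomial_boundP[c [e H]] /polynomial_boundP[c' [e' H']].
apply/polynomial_boundP; exists (c * c'), (e + e') => n.
by rewrite expnD mulnACA leq_mul.
Qed.

Lemma polynomial_bound_exp T d : polynomial_bound T -> polynomial_bound (fun n => T n ^ d).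
Proof.
move=> pT; elim: d => [|d IH]; first exact: polynomial_bound_const.
by apply: polynomial_bound_le (polynomial_bound_mul pT IH) => n; rewrite expnS.
Qed.

Lemma polynomial_bound_S T : polynomial_bound T -> polynomial_bound (fun n => (T n).+1).
Proof.
move=> pT; apply: polynomial_bound_le (polynomial_bound_add (polynomial_bound_const 1) pT) => n.
by rewrite add1n.
Qed.

Ltac polynomial := repeat first
  [ exact: polynomial_bound_const | exact: polynomial_bound_id | assumption
  | apply: polynomial_bound_add | apply: polynomial_bound_mul
  | apply: polynomial_bound_exp | apply: polynomial_bound_S ].

Lemma polynomial_bound_for B b : polynomial_bound B -> polynomial_bound b ->
  polynomial_bound (fun n => for_time (B n) (b n)).
Proof. by move=> pB pb; rewrite /for_time; polynomial. Qed.

Lemma polynomial_bound_set_bound c D : polynomial_bound (set_bound_time c D).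
Proof. rewrite /set_bound_time /multiply_time; polynomial. Qed.

(** * Codes of instances are uniquely decodable *)

Definition prefix_free (T : Type) (enc : T -> seq bool) :=
  forall x y u v, enc x ++ u = enc y ++ v -> x = y /\ u = v.

Lemma prefix_free_bit : prefix_free (fun b : bool => [:: b]).
Proof. by move=> x y u v [-> ->]. Qed.

Lemma prefix_free_seq T (enc : T -> seq bool) : prefix_free enc -> prefix_free (encode_seq enc).
Proof.
move=> pf; elim=> [|x s IH] [|y t] u v //=; first by case.
rewrite /encode_seq /= -!catA => -[/pf[-> e]].
by have [|-> ->] := IH t u v; rewrite // /encode_seq -!catA.
Qed.

Lemma prefix_free_option T (enc : T -> seq bool) :
  prefix_free enc -> prefix_free (encode_option enc).
Proof. by move=> pf [x|] [y|] u v //= [] // /pf[-> ->]. Qed.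

Lemma prefix_free_pair S T (enc : S -> seq bool) (enc' : T -> seq bool) :
  prefix_free enc -> prefix_free enc' -> prefix_free (fun x => enc x.1 ++ enc' x.2).
Proof.
by move=> pf pf' [x x'] [y y'] u v /=; rewrite -!catA => /pf[-> /pf'[-> ->]].
Qed.

(** Horner evaluation recovers a number from its digits, whence the injectivity
    of [binary]. *)
Lemma binary_digits k n : n < 2 ^ k ->
  foldr (fun (b : bool) m => b + m.*2) 0 [seq odd (n %/ 2 ^ i) | i <- iota 0 k] = n.
Proof.
elim: k n => [|k IH] n nk; first by case: n nk.
rewrite /= expn0 divn1 -[1]addn0 iotaDl -map_comp.
rewrite (@eq_map _ _ _ (fun i => odd (n./2 %/ 2 ^ i))) ?IH ?odd_double_half //.
  by rewrite expnS in nk; lia.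
by move=> i /=; rewrite add1n expnS divnMA divn2.
Qed.

Lemma binary_inj : injective binary.
Proof.
have dec n : foldr (fun (b : bool) m => b + m.*2) 0 (binary n) = n.
  by apply: binary_digits; apply: up_logP.
by move=> m n e; rewrite -(dec m) e dec.
Qed.

Lemma prefix_free_nat : prefix_free encode_nat.
Proof.
by move=> m n u v /(prefix_free_seq prefix_free_bit)[/binary_inj -> ->].
Qed.

Lemma prefix_free_rat : prefix_free encode_rat.
Proof.
move=> x y u v e; pose data (r : rat) := ((numq r < 0)%R, (`|numq r|, `|denq r|)%N).
have := prefix_free_pair prefix_free_bit (prefix_free_pair prefix_free_nat prefix_free_nat).
move=> /(_ (data x) (data y) u v e)[[sgn num den] ->].
split=> //; rewrite -[x]divq_num_den -[y]divq_num_den; congr (_%:~R / _%:~R)%R.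
  by move: sgn num; lia.
by have := denq_gt0 x; have := denq_gt0 y; move: den; lia.
Qed.

Lemma flatten_prefix_free (I : eqType) T (enc : T -> seq bool) (s : seq I) (f g : I -> T) :
  prefix_free enc -> flatten [seq enc (f i) | i <- s] = flatten [seq enc (g i) | i <- s] ->
  {in s, f =1 g}.
Proof.
move=> pf; elim: s => //= j s IH /pf[fg /IH e] i; rewrite inE => /predU1P[->//|]; exact: e.
Qed.

Section EncodingInjective.

Definition node_data n (N : protection_instance 'I_n) (i : 'I_n) : option rat * option rat :=
  (if i \in MI N then Some (cI N i) else None, if i \in MP N then Some (cP N i) else None).

Definition edge_data n (N : protection_instance 'I_n) (e : {set 'I_n}) : option (option rat) :=
  if e \in edges N then Some (if e \in ML N then Some (cL N e) else None) else None.

Definition encode_node_data (x : option rat * option rat) :=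
  encode_option encode_rat x.1 ++ encode_option encode_rat x.2.

Lemma prefix_free_node : prefix_free encode_node_data.
Proof. by apply: prefix_free_pair; apply/prefix_free_option/prefix_free_rat. Qed.

Definition index_pairs n := [seq (i, j) | i : 'I_n <- enum 'I_n,
  j : 'I_n <- [seq j : 'I_n <- enum 'I_n | i < j]].

(** The code is a concatenation of prefix-free codes of the data attached to the
    nodes and to the pairs of nodes. *)
Lemma encode_protectionE n (N : protection_instance 'I_n) :
  encode_protection N =
  encode_seq encode_node_data [seq node_data N i | i <- enum 'I_n] ++
  flatten [seq encode_option (encode_option encode_rat) (edge_data N [set ij.1; ij.2])
           | ij <- index_pairs n].
Proof.
rewrite /encode_protection /encode_seq -map_comp; congr (_ ++ flatten _).
rewrite map_allpairs; apply: eq_allpairs => i j.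
by rewrite /encode_pair /edge_data; case: ifP.
Qed.

Lemma encode_protection_inj_size n1 n2 (N1 : protection_instance 'I_n1)
    (N2 : protection_instance 'I_n2) :
  encode_protection N1 = encode_protection N2 -> n1 = n2.
Proof.
rewrite !encode_protectionE => /(prefix_free_seq prefix_free_node)[/(congr1 size) + _].
by rewrite size_map size_enum_ord size_map size_enum_ord.
Qed.

Variables (n : nat) (N1 N2 : protection_instance 'I_n).
Hypothesis eq_code : encode_protection N1 = encode_protection N2.

Lemma encode_protection_inj_data :
  node_data N1 =1 node_data N2 /\ edge_data N1 =1 edge_data N2.
Proof.
move: eq_code; rewrite !encode_protectionE.
move=> /(prefix_free_seq prefix_free_node)[/eq_in_map nodes /flatten_prefix_free eqe]; split.
  by move=> i; apply: nodes; rewrite mem_enum.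
have {}eqe (i j : 'I_n) : i < j -> edge_data N1 [set i; j] = edge_data N2 [set i; j].
  move=> ij; apply: (eqe _ (i, j)).
    exact/prefix_free_option/prefix_free_option/prefix_free_rat.
  apply/allpairsPdep; exists i, j; split=> //; first by rewrite mem_enum.
  by rewrite mem_filter mem_enum ij.
have {}eqe (e : {set 'I_n}) : #|e| = 2 -> edge_data N1 e = edge_data N2 e.
  move/eqP/cards2P=> [i [j [ij ->]]].
  case: (ltngtP i j) => [/eqe//|/eqe|/val_inj eij]; first by rewrite setUC.
  by rewrite eij eqxx in ij.
move=> e; case: (eqVneq #|e| 2) => [/eqe//|ne]; rewrite /edge_data.
by rewrite !ifN //; apply: contraNN ne => /edges_card2/eqP.
Qed.

(** The code leaves open only the costs outside [MI], [ML] and [MP], and these do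
    not enter the cost of a solution. *)
Lemma encode_protection_transfer (s : protection 'I_n) K :
  support_feasible N1 s /\ perfect_protection N1 s -> (protection_cost N1 s <= K)%R ->
  support_feasible N2 s /\ perfect_protection N2 s /\ (protection_cost N2 s <= K)%R.
Proof.
have [hn he] := encode_protection_inj_data.
have eE : edges N1 = edges N2.
  by apply/setP=> e; have := he e; rewrite /edge_data; case: (_ \in edges N1); case: (_ \in edges N2).
have eML : ML N1 = ML N2.
  apply/setP=> e; have := he e; rewrite /edge_data.
  have [/subsetP /(_ e) s1 /subsetP /(_ e) s2] := (ML_edges N1, ML_edges N2).
  move: s1 s2; case: (e \in ML N1) => [/(_ isT)->|_];
    case: (e \in ML N2) => [/(_ isT)->|_] //; by case: ifP.
have eMI : MI N1 = MI N2.
  by apply/setP=> i; have [+ _] := hn i; case: (_ \in MI N1); case: (_ \in MI N2).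
have eMP : MP N1 = MP N2.
  by apply/setP=> i; have [_] := hn i; case: (_ \in MP N1); case: (_ \in MP N2).
have ecI i : i \in MI N2 -> cI N1 i = cI N2 i.
  by move=> h; have [] := hn i; rewrite eMI h => -[].
have ecP i : i \in MP N2 -> cP N1 i = cP N2 i.
  by move=> h; have [_] := hn i; rewrite eMP h => -[].
have ecL e : e \in ML N2 -> cL N1 e = cL N2 e.
  move=> h; have := he e; rewrite /edge_data eML h eE.
  by rewrite (subsetP (ML_edges N2)) // => -[].
move=> [[f1 f2 f3] pp] le; split; [|split].
- by split=> [i|e|k]; rewrite -?eMI -?eML -?eMP; [apply: f1|apply: f2|apply: f3].
- by move: pp; rewrite /perfect_protection /edgesL /edgesP0 /nodesP eE.
- apply: le_trans le; rewrite /protection_cost eMI eML eMP.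
  rewrite (eq_bigr (fun i => cI N1 i * (xvar s i)%:R)%R) => [|i /ecI-> //].
  rewrite [X in (_ + X + _ <= _)%R](eq_bigr (fun i => cL N1 i * (yvar s i)%:R)%R) => [|i /ecL-> //].
  by rewrite [X in (_ + X <= _)%R](eq_bigr (fun i => cP N1 i * (zvar s i)%:R)%R) => [|i /ecP-> //].
Qed.

End EncodingInjective.

(** * Weighted domination as a protection problem *)

Lemma eq_set2 (T : finType) (i j a b : T) : a != b -> [set i; j] = [set a; b] ->
  i = a /\ j = b \/ i = b /\ j = a.
Proof.
move=> ab /setP e; have := e a; have := e b; have := e i; have := e j.
rewrite !inE !eqxx !orbT /= => /esym/orP[]/eqP-> /esym/orP[]/eqP->.
- by rewrite eqxx orbb eq_sym (negbTE ab).
- by right.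
- by left.
- by rewrite eqxx orbb (negbTE ab).
Qed.

Definition dominating (V : finType) (e : rel V) (D : {set V}) :=
  forall v, v \in D \/ exists2 u, u \in D & e u v.

Section Domination.
Variables (V : finType) (e : rel V) (price : V -> option rat).
Hypotheses (e_sym : symmetric e) (e_irr : irreflexive e).
Hypotheses (V0 : 0 < #|V|) (e_conn : forall u v, connect e u v).

Definition index_edges : {set {set 'I_#|V|}} :=
  [set ij | [exists i, exists j, (ij == [set i; j]) && e (enum_val i) (enum_val j)]].

Lemma mem_index_edges i j : ([set i; j] \in index_edges) = e (enum_val i) (enum_val j).
Proof.
rewrite inE; apply/existsP/idP => [[a /existsP[b /andP[/eqP ij eab]]]|eij]; last first.
  by exists i; apply/existsP; exists j; rewrite eqxx.
have ab : a != b by apply: contraTneq eab => ->; rewrite e_irr.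
by have [[-> ->]|[-> ->]] := eq_set2 ab ij; rewrite // e_sym.
Qed.

Lemma index_edges_card2 ij : ij \in index_edges -> #|ij| = 2.
Proof.
rewrite inE => /existsP[i /existsP[j /andP[/eqP-> eij]]]; rewrite cards2.
by rewrite (_ : i != j) //; apply: contraTneq eij => ->; rewrite e_irr.
Qed.

Lemma index_edges_connected : graph_connected index_edges.
Proof.
split=> [|i j]; first by rewrite card_ord.
have /connectP[p pth lst] := e_conn (enum_val i) (enum_val j).
apply/connectP; exists (map enum_rank p).
  rewrite -[i]enum_valK; elim: p (enum_val i) pth {lst} => //= v p IH u /andP[uv /IH ->].
  by rewrite mem_index_edges !enum_rankK uv.
by rewrite -[i]enum_valK last_map -lst enum_valK.
Qed.

Fact index_ML_edges : set0 \subset index_edges. Proof. exact: sub0set. Qed.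

(** The vertices in [MP] are those that have a price. *)
Definition domination_instance : protection_instance 'I_#|V| :=
  {| edges := index_edges; edges_card2 := index_edges_card2;
     edges_connected := index_edges_connected;
     MI := set0; ML := set0; MP := [set i | price (enum_val i) != None];
     ML_edges := index_ML_edges;
     cI := fun=> 0%R; cL := fun=> 0%R; cP := fun i => odflt 0%R (price (enum_val i)) |}.

Notation N := domination_instance.

Definition chosen (s : protection 'I_#|V|) : {set V} := [set v | zvar s (enum_rank v)].

Lemma domination_cost s : (forall v, v \in chosen s -> price v != None) ->
  protection_cost N s = (\sum_(v in chosen s) odflt 0 (price v))%R.
Proof.
move=> mp; rewrite /protection_cost !big_set0 !add0r.
rewrite (reindex enum_rank) /=; last exact/onW_bij/enum_rank_bij.
rewrite big_mkcond [RHS]big_mkcond; apply: eq_bigr => v _.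
have := mp v; rewrite !inE enum_rankK; case: (zvar s _) => [->|_] //.
  by rewrite mulr1.
by rewrite mulr0 if_same.
Qed.

Lemma nodesP_chosen s : nodesP N s = setT <-> dominating e (chosen s).
Proof.
split=> [all v|dom].
  have : enum_rank v \in nodesP N s by rewrite all inE.
  rewrite inE => /orP[zv|/existsP[k /andP[zk]]]; first by left; rewrite inE.
  rewrite mem_index_edges enum_rankK e_sym => kv; right; exists (enum_val k) => //.
  by rewrite inE enum_valK.
apply/setP=> i; rewrite !inE; apply/orP.
have [|[u]] := dom (enum_val i); rewrite inE ?enum_valK; first by left.
move=> zu uv; right; apply/existsP; exists (enum_rank u).
by rewrite zu mem_index_edges enum_rankK e_sym.
Qed.

(** Without links and node indicators every edge joins a protected node to the
    extra node, and the graph is connected if and only if it is a full star. *)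
Lemma perfect_protection_star s : nodesI s = set0 -> edgesL N s = set0 ->
  perfect_protection N s <-> nodesP N s = setT.
Proof.
move=> x0 y0; rewrite /perfect_protection x0 y0 imset0.
have g0 g : [set lift_edge (g i) | i in (set0 : {set 'I_#|V|})] = set0 by rewrite imset0.
split=> [[g [_ [_]]]|all].
  rewrite set0U g0 setU0 => conn; apply/setP=> i; rewrite in_setT.
  have /connectP[[|b p] //= /andP[/imsetP[k kP ib] _] _] := conn (Some i) None.
  have : Some i \in [set Some k; None] by rewrite -ib !inE eqxx.
  by rewrite in_set2 orbF => /eqP[->].
exists (fun=> set0); split; first by move=> i; rewrite inE.
split; first by rewrite card_option.
rewrite set0U g0 setU0.
have star i : [set Some i; None] \in edgesP0 N s.
  by apply/imsetP; exists i; rewrite ?all ?inE.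
have to0 u : connect (fun a b => [set a; b] \in edgesP0 N s) u None.
  by case: u => [i|]; [apply: connect1|apply: connect0].
have from0 u : connect (fun a b => [set a; b] \in edgesP0 N s) None u.
  by case: u => [i|]; [apply: connect1; rewrite setUC|apply: connect0].
by move=> u v; apply: connect_trans (to0 u) (from0 v).
Qed.

Lemma domination_protection K :
  (exists2 s, support_feasible N s /\ perfect_protection N s & (protection_cost N s <= K)%R) <->
  (exists D : {set V}, [/\ forall v, v \in D -> price v != None, dominating e D
     & (\sum_(v in D) odflt 0 (price v) <= K)%R]).
Proof.
split=> [[s [[f1 f2 f3] pp] le]|[D [mp dom le]]].
  have mp v : v \in chosen s -> price v != None.
    by rewrite inE; apply: contraTneq => pv; rewrite f3 // inE enum_rankK pv.
  exists (chosen s); split=> //; last by rewrite -domination_cost.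
  apply/nodesP_chosen/perfect_protection_star => //.
    by apply/setP=> i; rewrite !inE f1 ?inE.
  by apply/setP=> y; rewrite !inE f2 ?inE ?andbF.
pose s := Protection [ffun=> false] [ffun=> false] [ffun i : 'I_#|V| => enum_val i \in D].
have sD : chosen s = D by apply/setP=> v; rewrite inE ffunE enum_rankK.
exists s; last by rewrite domination_cost sD.
split.
  split=> [i|y|k]; rewrite /s /= ffunE // inE => nk; apply/negP => /mp; exact/negP.
apply/perfect_protection_star.
- by apply/setP=> i; rewrite !inE ffunE.
- by apply/setP=> y; rewrite !inE ffunE andbF.
- by apply/nodesP_chosen; rewrite sD.
Qed.

Lemma decision_domination :
  decision_version perfect_protection_problem (encode_rat 0 ++ encode_protection N) <->
  (exists D : {set V}, [/\ forall v, v \in D -> price v != None, dominating e D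
     & (\sum_(v in D) odflt 0 (price v) <= 0)%R]).
Proof.
rewrite -domination_protection; split=> [[[m N'] [K [/= code [s [feas le]]]]]|[s feas le]].
  move: code => /prefix_free_rat[eK code]; rewrite -eK in le.
  have em := encode_protection_inj_size code; move: N' s feas le code; rewrite -em => N' s feas le code.
  by have [sf [pp le']] := encode_protection_transfer (esym code) feas le; exists s.
by exists (existT _ #|V| N), 0%R; split=> //; exists s.
Qed.

End Domination.

(** * Machine computations as tilings of a square *)

(** [fits_at] is a condition on a single tile; it is told whether the cell is in
    the first row, the last row, the first column, the last column, and which
    bit of the input, if any, has the index of the column.  [above l g r g']
    states that [g'] may come after [g] in the next row, when the neighbours of
    [g] are [l] and [r]. *)
Record tile_system := TileSystem {
  tile : finType;
  fits_at : bool -> bool -> bool -> bool -> option bool -> tile -> bool;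
  above : tile -> tile -> tile -> tile -> bool
}.

(** At a border the missing neighbour is arbitrary: [above] has to hold for all
    its values. *)
Definition tiling (S : tile_system) (B : nat) (w : seq bool) (phi : nat -> nat -> tile S) :=
  (forall t p, t < B -> p < B ->
     fits_at (t == 0) (t.+1 == B) (p == 0) (p.+1 == B) (onth w p) (phi t p)) /\
  (forall t p l r, t.+1 < B -> p < B ->
     (0 < p -> l = phi t p.-1) -> (p.+1 < B -> r = phi t p.+1) ->
     above l (phi t p) r (phi t.+1 p)).

Section MachineTiles.
Variable M : machine.
Notation tape := 'I_(last_tape M).+1.
Notation scan := {ffun tape -> symbol (work M)}.

(** Idling is permitted in accepting states only; it makes an accepting run as
    long as needed. *)
Definition idle (q : state M) (s : scan) : action M := (q, s, [ffun=> Stay]).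

Definition allowed (q : state M) (s : scan) (a : action M) : bool :=
  (a \in trans q s) || (q \in accepting M) && (a == idle q s).

Definition view (c : config M) : scan := [ffun i => cell c i (head c i)].

Lemma act_idle c : act (idle (cstate c) (view c)) c = c.
Proof.
case: c => q h f; rewrite /act /=; congr Config; apply: functional_extensionality => i.
  by rewrite ffunE.
by apply: functional_extensionality => p; rewrite ffunE; case: eqP => [->|].
Qed.

Lemma reaches_rcons t (c c' : config M) a : reaches t c c' -> a \in enabled c' ->
  reaches t.+1 c (act a c').
Proof.
elim=> {t c c'} [c ac|t c a' c' a'c _ IH ac]; first exact: reachesS ac (reaches0 _).
exact: reachesS a'c (IH ac).
Qed.

(** The run is continued forever by idling. *)
Lemma history t (c c' : config M) : reaches t c c' -> cstate c' \in accepting M ->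
  exists (cs : nat -> config M) (acts : nat -> action M),
    [/\ cs 0 = c,
        forall j, allowed (cstate (cs j)) (view (cs j)) (acts j),
        forall j, cs j.+1 = act (acts j) (cs j)
      & forall j, t <= j -> cstate (cs j) \in accepting M].
Proof.
elim=> {t c c'} [c|t c a c' ac _ IH] acc.
  exists (fun=> c), (fun=> idle (cstate c) (view c)); split=> // j.
    by rewrite /allowed acc eqxx orbT.
  by rewrite act_idle.
have [cs [acts [cs0 al step fin]]] := IH acc.
exists (fun j => if j is j'.+1 then cs j' else c).
exists (fun j => if j is j'.+1 then acts j' else a); split=> //.
- by case=> [|j] //=; rewrite /allowed; apply/orP; left.
- by case=> [|j] /=; rewrite ?cs0 ?step.
- by case=> [|j] //; apply: fin.
Qed.

(** A tile records whether its cell is in the first or the last column, the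
    control of its row (state, scanned symbols, action), and for each tape the
    symbol in the cell and whether the head is there. *)
Definition machine_tile : finType :=
  ((bool * bool) * (state M * scan * action M) * {ffun tape -> symbol (work M) * bool})%type.

Definition first_col (g : machine_tile) : bool := g.1.1.1.
Definition last_col (g : machine_tile) : bool := g.1.1.2.
Definition control (g : machine_tile) : state M * scan * action M := g.1.2.
Definition content (g : machine_tile) (i : tape) : symbol (work M) := (g.2 i).1.
Definition here (g : machine_tile) (i : tape) : bool := (g.2 i).2.

Definition machine_fits (ft lt fp lp : bool) (o : option bool) (g : machine_tile) : bool :=
  [&& (first_col g == fp), (last_col g == lp),
    allowed (control g).1.1 (control g).1.2 (control g).2,
    [forall i, here g i ==> ((control g).1.2 i == content g i)],
    ft ==> (((control g).1.1 == start M) &&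
           [forall i, (content g i == if i == ord0 then omap inl o else None) && (here g i == fp)])
    & lt ==> ((control g).1.1 \in accepting M)].

(** The control is compared with that of the left neighbour only; propagated
    along the row, this makes it constant. *)
Definition machine_above (l g r g' : machine_tile) : bool :=
  let a := (control g).2 in
  [&& (control g').1.1 == a.1.1,
      first_col g || (control l == control g)
    & [forall i, (content g' i == if here g i then a.1.2 i else content g i) &&
       (here g' i == match a.2 i with
          | Stay => here g i
          | MoveRight => ~~ first_col g && here l i
          | MoveLeft => (~~ last_col g && here r i) || first_col g && here g i
          end)]].

Definition machine_tiles : tile_system := @TileSystem machine_tile machine_fits machine_above.

Lemma tape_of_onth w p : tape_of M w p = omap inl (onth w p).
Proof.
rewrite /tape_of; elim: w p => [|b w IH] [|p] //=; by rewrite nth_nil.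
Qed.

Definition tile_at_cell B (c : config M) a p : machine_tile :=
  ((p == 0, p.+1 == B), (cstate c, view c, a), [ffun i => (cell c i p, p == head c i)]).

(** A head is at most at position [t] in row [t], so that it never leaves the
    square. *)
Lemma tiling_of_accepts w t B : t < B -> accepts_in M t w ->
  exists phi, tiling (S := machine_tiles) B w phi.
Proof.
move=> tB [c [rc acc]]; have [cs [acts [cs0 al step fin]]] := history rc acc.
have slow j i : head (cs j) i <= j.
  elim: j => [|j IHj]; first by rewrite cs0.
  by rewrite step /=; case: ((acts j).2 i) => /=; lia.
exists (fun t p => tile_at_cell B (cs t) (acts t) p); split.
  move=> {}t' p t'B pB; apply/and5P; split; rewrite ?eqxx ?al //.
  - by apply/forallP=> i; rewrite /here /content /control /= !ffunE /=; apply/implyP=> /eqP ->.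
  - apply/andP; split.
      apply/implyP => /eqP ->; rewrite cs0 eqxx; apply/forallP=> i.
      rewrite /content /here !ffunE /= eqxx andbT tape_of_onth.
      by case: ifP => // _; case: p {pB}.
    by apply/implyP => /eqP e; apply: fin; lia.
move=> {}t' p l r t'B pB hl hr; rewrite /= /machine_above /= step.
rewrite eqxx /=; apply/andP; split.
  by case: p pB hl hr => [|p] pB hl hr //=; rewrite hl //= eqxx.
apply/forallP=> i; rewrite /here /content !ffunE /= /first_col /last_col /=.
rewrite eqxx /=; apply/eqP; case: ((acts t').2 i) => /=.
- case: (ltnP p.+1 B) => pB'.
    by rewrite hr // /tile_at_cell !ffunE /=; lia.
  have -> /= : p.+1 == B by lia.
  by have := slow t' i; lia.
- by [].
- case: p pB hl hr => [|p] pB hl hr //=.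
  by rewrite hl // /tile_at_cell !ffunE /=; lia.
Qed.

(** Row after row, either the tiling describes a genuine configuration reached
    by the machine, or an idling step shows that it has already accepted. *)
Lemma accepts_of_tiling w B phi : tiling (S := machine_tiles) B.+1 w phi ->
  exists t, accepts_in M t w.
Proof.
move=> [fit ab].
have {}fit t p : t < B.+1 -> p < B.+1 ->
  [/\ first_col (phi t p) = (p == 0), last_col (phi t p) = (p.+1 == B.+1),
   allowed (control (phi t p)).1.1 (control (phi t p)).1.2 (control (phi t p)).2,
   forall i, here (phi t p) i -> (control (phi t p)).1.2 i = content (phi t p) i &
   (t = 0 -> (control (phi t p)).1.1 = start M /\
      forall i, content (phi t p) i = (if i == ord0 then omap inl (onth w p) else None)
        /\ here (phi t p) i = (p == 0)) /\
   (t = B -> (control (phi t p)).1.1 \in accepting M)].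
  move=> tB pB; have /and5P[/eqP f1 /eqP f2 f3 /forallP f4 /andP[f5 f6]] := fit t p tB pB.
  split=> //.
  - by move=> i hi; have := f4 i; rewrite hi => /eqP.
  - split=> e; last by move: f6; rewrite e eqxx.
    move: f5; rewrite e /= => /andP[/eqP -> /forallP f5]; split=> // i.
    by have /andP[/eqP -> /eqP ->] := f5 i.
pose good t (c : config M) := [/\ reaches t (init M w) c,
  forall p, p <= B -> (control (phi t p)).1.1 = cstate c,
  forall p i, p <= B -> content (phi t p) i = cell c i p,
  forall p i, p <= B -> here (phi t p) i = (p == head c i)
  & forall i, head c i <= t].
suff main t : t <= B -> (exists t', accepts_in M t' w) \/ exists c, good t c.
  have [//|[c [rc cq _ _ _]]] := main B (leqnn B).
  have [_ _ _ _ [_ /(_ erefl)]] := fit B 0 (ltnSn B) isT.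
  by rewrite cq // => acc; exists B, c.
elim: t => [|t IH] tB.
  right; exists (init M w); split; first exact: reaches0.
  - by move=> p pB; have [_ _ _ _ [/(_ erefl)[]]] := fit 0 p isT pB.
  - move=> p i pB; have [_ _ _ _ [/(_ erefl)[_ /(_ i)[-> _]] _]] := fit 0 p isT pB.
    by rewrite /= tape_of_onth; case: ifP => // _; case: (p).
  - by move=> p i pB; have [_ _ _ _ [/(_ erefl)[_ /(_ i)[_ ->]] _]] := fit 0 p isT pB.
  - by [].
have [|[c [rc cq cc ch ct]]] := IH (ltnW tB); first by left.
have ctl p : p <= B -> control (phi t p) = control (phi t 0).
  elim: p => // p IHp pB; rewrite -(IHp (ltnW pB)).
  have := ab t p.+1 (phi t p) (phi t p.+2) tB pB (fun _ => erefl) (fun _ => erefl).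
  rewrite /= /machine_above => /and3P[_ + _].
  have [-> _ _ _ _] := fit t p.+1 (ltnW tB) pB; by move=> /= /eqP.
have hB i : head c i <= B by apply: leq_trans (ct i) (ltnW tB).
have sc : (control (phi t 0)).1.2 = view c.
  apply/ffunP=> i; rewrite ffunE -(ctl _ (hB i)).
  have [_ _ _ h _] := fit t (head c i) (ltnW tB) (hB i).
  by rewrite h ?cc ?ch.
have [_ _ + _ _] := fit t 0 (ltnW tB) isT; rewrite /allowed sc cq // => /orP[ac|/andP[acc _]]; last first.
  by left; exists t, c.
right; exists (act (control (phi t 0)).2 c).
have key p l r : p <= B -> (0 < p -> l = phi t p.-1) -> (p < B -> r = phi t p.+1) ->
  (control (phi t.+1 p)).1.1 = (control (phi t 0)).2.1.1 /\ forall i,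
  content (phi t.+1 p) i = (if here (phi t p) i then (control (phi t 0)).2.1.2 i else content (phi t p) i)
  /\ here (phi t.+1 p) i = match (control (phi t 0)).2.2 i with
          | Stay => here (phi t p) i
          | MoveRight => (p != 0) && here l i
          | MoveLeft => (p != B) && here r i || (p == 0) && here (phi t p) i
          end.
  move=> pB hl hr; have := ab t p l r tB pB hl hr; rewrite /= /machine_above (ctl p pB).
  have [-> -> _ _ _] := fit t p (ltnW tB) pB.
  move=> /and3P[/eqP -> _ /forallP h]; split=> // i.
  by have /andP[/eqP -> /eqP ->] := h i.
split.
- by apply: reaches_rcons rc _; rewrite /enabled.
- by move=> p pB; have [->] := key p (phi t p.-1) (phi t p.+1) pB (fun _ => erefl) (fun _ => erefl).
- move=> p i pB; have [_ /(_ i)[-> _]] := key p (phi t p.-1) (phi t p.+1) pB (fun _ => erefl) (fun _ => erefl).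
  by rewrite /= ch // cc.
- move=> p i pB; have [_ /(_ i)[_ ->]] := key p (phi t p.-1) (phi t p.+1) pB (fun _ => erefl) (fun _ => erefl).
  rewrite /=; have := ct i; rewrite (ch p i pB); case: ((control (phi t 0)).2.2 i) => /= hi.
  + case: (ltnP p B) => pB'; first by rewrite ch //; lia.
    have -> : p = B by lia.
    by rewrite eqxx /=; lia.
  + by [].
  + case: p pB => [|p] pB //=; rewrite ch //; lia.
- by move=> i /=; have := ct i; case: ((control (phi t 0)).2.2 i) => /=; lia.
Qed.

End MachineTiles.

(** * Tilings as cheap dominating sets *)

(** Besides tiles, cells and rules, there is a bonus at each position.  The hub
    at the origin is chosen for free and dominates all that carries no
    condition; the relay at the origin, which cannot be chosen, connects cells
    and rules to the rest of the graph without dominating them. *)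
Inductive kind (G : Type) :=
  Hub | Relay | Bonus | Cell | Tile of G | Rule of G & G & G.
Arguments Hub {G}.
Arguments Relay {G}.
Arguments Bonus {G}.
Arguments Cell {G}.

Section Kind.
Variable G : finType.
Definition kind_code (k : kind G) : 'I_4 + G + G * G * G :=
  match k with
  | Hub => inl (inl (inord 0)) | Relay => inl (inl (inord 1))
  | Bonus => inl (inl (inord 2)) | Cell => inl (inl (inord 3))
  | Tile g => inl (inr g) | Rule l g r => inr (l, g, r)
  end.
Definition kind_decode (c : 'I_4 + G + G * G * G) : kind G :=
  match c with
  | inl (inl i) => nth Cell [:: Hub; Relay; Bonus] i
  | inl (inr g) => Tile g
  | inr (l, g, r) => Rule l g r
  end.
Fact kind_codeK : cancel kind_code kind_decode.
Proof. by case=> //=; rewrite inordK. Qed.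
HB.instance Definition _ := Finite.copy (kind G) (can_type kind_codeK).
End Kind.

(** All that adjacency depends on, as finitely many bits: this is what the
    printing machine scans.  [row_above] means that [far] is in the row that
    comes just after that of [near]. *)
Record place := Place {
  on_first_row : bool; on_last_row : bool; on_first_col : bool; on_last_col : bool }.

Record sight := Sight {
  near : place; far : place;
  same_row : bool; row_above : bool; row_below : bool;
  same_col : bool; col_right : bool; col_left : bool;
  bit_here : option bool }.

(** Only the letter of the input at the first position is known, so that
    flipping is not exact for the last field. *)
Definition flip (s : sight) : sight :=
  Sight (far s) (near s) (same_row s) (row_below s) (row_above s)
        (same_col s) (col_left s) (col_right s) (bit_here s).

Definition place_of (B t p : nat) : place :=
  Place (t == 0) (t.+1 == B) (p == 0) (p.+1 == B).

Definition sight_of (B : nat) (w : seq bool) (t p t' p' : nat) : sight :=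
  Sight (place_of B t p) (place_of B t' p')
        (t == t') (t' == t.+1) (t == t'.+1) (p == p') (p' == p.+1) (p == p'.+1)
        (onth w p).

Section Graph.
Variable S : tile_system.
Notation G := (tile S).

Definition origin (x : place) := on_first_row x && on_first_col x.

(** Hubs and relays away from the origin only serve to have all kinds at all
    positions; they are dominated by the hub, as are the rules of the last row,
    which have no next row to speak about. *)
Definition arc (s : sight) (k k' : kind G) : bool :=
  let x := near s in
  match k, k' with
  | Hub, Hub => origin x && ~~ origin (far s)
  | Hub, (Relay | Bonus | Tile _) => origin x
  | Hub, Rule _ _ _ => origin x && on_last_row (far s)
  | Relay, (Cell | Rule _ _ _) => origin x
  | Cell, Tile g => [&& same_row s, same_col s
      & fits_at (on_first_row x) (on_last_row x) (on_first_col x) (on_last_col x) (bit_here s) g]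
  | Rule l g r, Tile g' =>
      [|| [&& same_row s, col_left s & g' != l],
          [&& same_row s, same_col s & g' != g],
          [&& same_row s, col_right s & g' != r]
        | [&& row_above s, same_col s & above l g r g']]
  | _, _ => false
  end.

Definition linked (s : sight) (k k' : kind G) := arc s k k' || arc (flip s) k' k.

(** The input bit matters only between a cell and a tile at the same position,
    where both ends see the same bit. *)
Lemma arc_flip B w t p t' p' k k' :
  arc (flip (sight_of B w t p t' p')) k' k = arc (sight_of B w t' p' t p) k' k.
Proof.
case: k' k => [||||g'|l' g' r'] [||||g|l g r] //=; rewrite !(eq_sym t' t) !(eq_sym p' p) //.
by case: (t =P t') => //= _; case: (p =P p') => //= ->.
Qed.

Variables (b : nat) (w : seq bool).
Notation B := b.+1.
Definition vertex : finType := ('I_B * 'I_B * kind G)%type.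

Definition arrow (u v : vertex) :=
  arc (sight_of B w u.1.1 u.1.2 v.1.1 v.1.2) u.2 v.2.

Definition adj (u v : vertex) := arrow u v || arrow v u.

Lemma adjE u v : adj u v = linked (sight_of B w u.1.1 u.1.2 v.1.1 v.1.2) u.2 v.2.
Proof. by rewrite /linked arc_flip. Qed.

Lemma adj_sym u v : adj u v = adj v u. Proof. by rewrite /adj orbC. Qed.

Lemma adj_irr u : adj u u = false.
Proof. by rewrite /adj orbb /arrow; case: u => [x [||||g|l g r]] //=; rewrite andbN. Qed.

Definition hub : vertex := (ord0, ord0, Hub).
Definition relay : vertex := (ord0, ord0, Relay).

Lemma connect_hub v : connect adj hub v.
Proof.
have hr : connect adj hub relay by apply: connect1; rewrite /adj /arrow /=.
case: v => [[t p] [||||g|l g r]]; try by apply: connect1; rewrite /adj /arrow /=.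
- case: (boolP ((t == ord0) && (p == ord0))) => [/andP[/eqP-> /eqP->]|h]; first exact: connect0.
  by apply: connect1; rewrite /adj /arrow /= /origin /= h.
- by apply: connect_trans hr (connect1 _); rewrite /adj /arrow /=.
- by apply: connect_trans hr (connect1 _); rewrite /adj /arrow /=.
Qed.

Lemma adj_connected u v : connect adj u v.
Proof.
have cs : connect_sym adj by apply: sym_connect_sym => x y; rewrite adj_sym.
by apply: connect_trans (connect_hub v); rewrite cs connect_hub.
Qed.

(** Kinds without a price cannot be chosen. *)
Definition price (k : kind G) : option rat :=
  match k with
  | Hub => Some 0 | Bonus => Some (-1) | Tile _ => Some 1 | _ => None
  end%R.

Definition total_price (D : {set vertex}) : rat := (\sum_(v in D) odflt 0 (price v.2))%R.

Definition is_tile (v : vertex) := if v.2 is Tile _ then true else false.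
Definition is_bonus (v : vertex) := if v.2 is Bonus then true else false.

Lemma total_priceE D :
  (total_price D = #|[set v in D | is_tile v]|%:R - #|[set v in D | is_bonus v]|%:R)%R.
Proof.
rewrite /total_price -!sum1_card !natr_sum.
have E (P : pred vertex) : (\sum_(v in [set v in D | P v]) 1%:R = \sum_(v in D) (P v)%:R :> rat)%R.
  rewrite big_mkcond [RHS]big_mkcond /=; apply: eq_bigr => v _.
  by rewrite inE; case: (v \in D) => //=; case: (P v).
rewrite !E -sumrB; apply: eq_bigr => v _; rewrite /is_tile /is_bonus.
by case: v.2.
Qed.

Definition tile_at (f : 'I_B * 'I_B -> G) (x : 'I_B * 'I_B) : vertex := (x, Tile (f x)).
Definition bonus_at (x : 'I_B * 'I_B) : vertex := (x, Bonus).

Lemma tiles_card (f : 'I_B * 'I_B -> G) :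
  #|[set tile_at f x | x : 'I_B * 'I_B]| = #|{: 'I_B * 'I_B}|.
Proof. by rewrite card_imset // => x y []. Qed.

Lemma bonus_card : #|[set v : vertex | is_bonus v]| = #|{: 'I_B * 'I_B}|.
Proof.
have -> : [set v : vertex | is_bonus v] = [set bonus_at x | x : 'I_B * 'I_B].
  apply/setP=> -[x k]; rewrite inE; apply/idP/imsetP => [|[y _ [_ ->]]] //.
  by case: k => // _; exists x.
by rewrite card_imset // => x y [].
Qed.

(** All the hubs and bonuses are taken along, so that the bonuses pay for the
    tiles. *)
Definition cover_of (f : 'I_B * 'I_B -> G) : {set vertex} :=
  [set v | match v.2 with Hub | Bonus => true | Tile g => g == f v.1 | _ => false end].

Lemma cover_price f : total_price (cover_of f) = 0%R.
Proof.
rewrite total_priceE.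
have -> : [set v in cover_of f | is_tile v] = [set tile_at f x | x : 'I_B * 'I_B].
  apply/setP=> -[x k]; rewrite !inE /is_tile /=; apply/idP/imsetP => [|[y _ [-> ->]]] //.
    by case: k => //= g /andP[/eqP-> _]; exists x.
  by rewrite eqxx.
have -> : [set v in cover_of f | is_bonus v] = [set v | is_bonus v].
  by apply/setP=> -[x k]; rewrite !inE /is_bonus /=; case: k => //= g; rewrite andbF.
by rewrite tiles_card bonus_card subrr.
Qed.

Lemma cover_dominates phi : tiling B w phi ->
  dominating adj (cover_of (fun x => phi x.1 x.2)).
Proof.
move=> [fit ab] [[t p] k].
have hubD : hub \in cover_of (fun x => phi x.1 x.2) by rewrite inE.
pose tl (t p : 'I_B) : vertex := (t, p, Tile (phi t p)).
have tlD t' p' : tl t' p' \in cover_of (fun x => phi x.1 x.2) by rewrite inE /=.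
case: k => [||||g|l g r]; try first [by left; rewrite inE | by right; exists hub => //; rewrite /adj /arrow /=].
  right; exists (tl t p) => //; rewrite /adj /arrow /tl /= !eqxx /=.
  exact: fit (ltn_ord t) (ltn_ord p).
case: (boolP (t.+1 == B)) => [tl_last|tn].
  by right; exists hub => //; rewrite /adj /arrow /= tl_last.
have tB : t.+1 < B by have := ltn_ord t; lia.
have up (u : vertex) : u \in cover_of (fun x => phi x.1 x.2) -> arrow (t, p, Rule l g r) u ->
    exists2 u, u \in cover_of (fun x => phi x.1 x.2) & adj u (t, p, Rule l g r).
  by move=> uD a; exists u => //; rewrite /adj a orbT.
right; case: (eqVneq g (phi t p)) => [eg|ng]; last first.
  by apply: up (tlD t p) _; rewrite /arrow /tl /= !eqxx (eq_sym (phi t p) g) ng /= orbT.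
case: (boolP ((0 < p) && (l != phi t p.-1))) => [/andP[p0 nl]|hl].
  have p1B : p.-1 < B by have := ltn_ord p; lia.
  by apply: up (tlD t (Ordinal p1B)) _; rewrite /arrow /tl /= eqxx (eq_sym (phi t p.-1) l) nl prednK // eqxx.
case: (boolP ((p.+1 < B) && (r != phi t p.+1))) => [/andP[pB nr]|hr].
  by apply: up (tlD t (Ordinal pB)) _; rewrite /arrow /tl /= !eqxx (eq_sym (phi t p.+1) r) nr /= !orbT.
apply: up (tlD (Ordinal tB) p) _; rewrite /arrow /tl /= !eqxx eg /= ab ?orbT //.
- by move=> p0; move: hl; rewrite p0 negbK => /eqP.
- by move=> pB; move: hr; rewrite pB negbK => /eqP.
Qed.

(** Each cell needs a tile at its position, and the number of tiles chosen is at
    most the number of bonuses, which is the number of positions.  Hence there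
    is exactly one tile per position, and the rules can only be dominated by
    these. *)
Lemma tiling_of_dominating (D : {set vertex}) :
  (forall v, v \in D -> price v.2 != None) -> dominating adj D -> (total_price D <= 0)%R ->
  exists phi, tiling (S := S) B w phi.
Proof.
move=> mp dom le0.
have cell (x : 'I_B * 'I_B) : exists g, ((x, Tile g) \in D) &&
    fits_at ((x.1 : nat) == 0) (x.1.+1 == B) ((x.2 : nat) == 0) (x.2.+1 == B) (onth w x.2) g.
  case: (dom (x, Cell)) => [/mp //|[[y k] uD]]; have := mp _ uD.
  case: k uD => [||||g|l g r] uD //= _; rewrite /adj /arrow //= ?orbF.
  move=> /and3P[/eqP/val_inj e1 /eqP/val_inj e2 fit]; exists g; rewrite fit andbT.
  by rewrite [x]surjective_pairing e1 e2 -surjective_pairing.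
pose f x := xchoose (cell x).
have fD x : (x, Tile (f x)) \in D by have /andP[] := xchooseP (cell x).
have tE : [set v in D | is_tile v] = [set tile_at f x | x : 'I_B * 'I_B].
  apply/esym/eqP; rewrite eqEcard; apply/andP; split.
    by apply/subsetP=> v /imsetP[x _ ->]; rewrite inE fD.
  rewrite tiles_card -bonus_card.
  apply: (@leq_trans #|[set v in D | is_bonus v]|); last first.
    by apply/subset_leq_card/subsetP=> v; rewrite !inE => /andP[].
  by move: le0; rewrite total_priceE subr_le0 ler_nat.
have uniq_tile x g : (x, Tile g) \in D -> g = f x.
  move=> xD; have : (x, Tile g) \in [set v in D | is_tile v] by rewrite inE xD.
  by rewrite tE => /imsetP[y _ [-> ->]].
exists (fun t p => f (inord t, inord p)); split.
  move=> t p tB pB; have /andP[_] := xchooseP (cell (inord t, inord p)).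
  by rewrite -/(f _); move: (f _) => g; rewrite /= !inordK.
move=> t p l r tB pB hl hr.
have tB' := ltnW tB.
case: (dom (inord t, inord p, Rule l (f (inord t, inord p)) r)) => [/mp //|[[y k] uD]].
have := mp _ uD.
case: k uD => [||||g|l' g r'] uD //= _; rewrite /adj /arrow //= !inordK // ?orbF.
  by move=> /andP[_ /eqP e]; lia.
have yE (i j : nat) : i == y.1 :> nat -> j == y.2 :> nat -> (inord i, inord j) = y.
  by case: y uD => y1 y2 /= _ /eqP -> /eqP ->; rewrite !inord_val.
rewrite (uniq_tile _ _ uD) => /or4P[] /and3P[].
- move=> e1 /eqP e2 /negP[]; rewrite hl; last by rewrite e2.
  by rewrite -(yE t p.-1) ?eqxx // e2.
- by move=> e1 e2 /negP[]; rewrite -(yE t p).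
- move=> e1 e2 /negP[]; rewrite hr; last by rewrite -(eqP e2).
  by rewrite -(yE t p.+1) ?eqxx // eq_sym.
- by move=> e1 e2; rewrite -(yE t.+1 p) // eq_sym.
Qed.

End Graph.

(** * Enumeration of vertices in lexicographic order *)

Section Enumeration.

Lemma enum_val_enum (V : finType) : [seq enum_val i | i <- enum 'I_#|V|] = enum V.
Proof.
case: (pickP V) => [x0 _|V0].
  apply: (@eq_from_nth _ x0); first by rewrite size_map size_enum_ord cardE.
  move=> i; rewrite size_map size_enum_ord => iV.
  by rewrite (nth_map (Ordinal iV)) ?size_enum_ord // (enum_val_nth x0) nth_enum_ord.
have c0 : #|V| = 0 by apply: eq_card0.
have -> : enum V = [::] by apply: size0nil; rewrite -cardE.
by apply: size0nil; rewrite size_map size_enum_ord; exact: c0.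
Qed.

Lemma enum_pair (S T : finType) : enum {: S * T} = [seq (x, y) | x <- enum S, y <- enum T].
Proof. by rewrite [LHS]enumT unlock. Qed.

Lemma index_enum_rank (V : finType) (u : V) : index u (enum V) = enum_rank u.
Proof. by rewrite -[in LHS](nth_enum_rank u u) index_uniq ?enum_uniq // -cardE. Qed.

Lemma index_allpairs (S T : eqType) (s : seq S) (t : seq T) x y : x \in s -> y \in t ->
  index (x, y) [seq (a, b) | a <- s, b <- t] = index x s * size t + index y t.
Proof.
move=> + yt; elim: s => //= a s IH; rewrite inE index_cat.
have inj : injective (fun b : T => (a, b)) by move=> b b' [].
case: (eqVneq a x) => [->|ax] /=.
  by rewrite (mem_map (f := fun b => (x, b))) ?yt ?index_map // => b b' [].
move=> /IH ->.
rewrite ifN; first by rewrite size_map mulSn addnA.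
by apply/mapP=> -[b _ [e _]]; rewrite e eqxx in ax.
Qed.

Lemma enum_rank_pair (S T : finType) (x : S) (y : T) :
  enum_rank (x, y) = enum_rank x * #|T| + enum_rank y :> nat.
Proof.
by rewrite -!index_enum_rank enum_pair index_allpairs ?mem_enum // cardE.
Qed.

Lemma ltn_lex n a a' r r' : r < n -> r' < n ->
  (a * n + r < a' * n + r') = (a < a') || (a == a') && (r < r').
Proof.
move=> rn rn'; case: (ltngtP a a') => [lt|lt|->] /=; last by rewrite ltn_add2l.
  by have := leq_mul lt (leqnn n); rewrite mulSn; lia.
by have := leq_mul lt (leqnn n); rewrite mulSn; lia.
Qed.

Lemma enum_rank_pair_lt (S T : finType) (x x' : S) (y y' : T) :
  (enum_rank (x, y) < enum_rank (x', y')) =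
  (enum_rank x < enum_rank x') || (x == x') && (enum_rank y < enum_rank y').
Proof.
rewrite !enum_rank_pair ltn_lex; try exact: ltn_ord.
by rewrite -(inj_eq enum_rank_inj x) -val_eqE.
Qed.

Lemma flatten_map_pair (S T : finType) (F : S * T -> seq bool) :
  flatten [seq F u | u <- enum {: S * T}] =
  flatten [seq flatten [seq F (x, y) | y <- enum T] | x <- enum S].
Proof.
rewrite enum_pair; elim: (enum S) => //= x s IH.
by rewrite map_cat flatten_cat IH -map_comp.
Qed.

Lemma flatten_enum_ord n (F : nat -> seq bool) :
  flatten (map F (iota 0 n)) = flatten [seq F i | i : 'I_n <- enum 'I_n].
Proof. by rewrite -val_enum_ord -map_comp. Qed.

Lemma flatten_filter (I : Type) (s : seq I) (P : pred I) (F : I -> seq bool) :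
  flatten [seq F i | i <- s & P i] = flatten [seq (if P i then F i else [::]) | i <- s].
Proof. by elim: s => //= i s <-; case: (P i). Qed.

Lemma flatten_allpairs_dep (S : Type) (T : Type) (F : S -> T -> seq bool) (s : seq S) (t : S -> seq T) :
  flatten [seq F x y | x <- s, y <- t x] = flatten [seq flatten [seq F x y | y <- t x] | x <- s].
Proof. by elim: s => //= x s IH; rewrite flatten_cat IH. Qed.

End Enumeration.

(** * Printing the instance *)

Lemma prints_from_empty F b w h v : prints F b w h v ->
  computes F b (counters w h [::]) (counters w h v).
Proof. by move/(_ [::]). Qed.

Lemma prints_le F a b w h v : a <= b -> prints F a w h v -> prints F b w h v.
Proof. by move=> ab pF out; apply: computes_le ab (pF out). Qed.

Lemma prints_emit_eq g w h v : g (scanned (counters w h [::])) = v ->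
  prints (emit g) (\max_s size (g s) + 1) w h v.
Proof. by move=> <-; apply: prints_emit. Qed.

Section Printer.
Variable S : tile_system.
Notation G := (tile S).

Definition bit_of (x : csymbol) : option bool := if x is Some (inl b) then Some b else None.

Definition sight_scan (s : cscan) : sight :=
  Sight (Place (zero s 1) (one s 2) (zero s 3) (one s 4))
        (Place (zero s 5) (one s 6) (zero s 7) (one s 8))
        (zero s 9 && zero s 10) (one s 9) (one s 10)
        (zero s 11 && zero s 12) (one s 11) (one s 12)
        (bit_of (at_reg s 0)).

Lemma sight_scanE c B e w out :
  sight_scan (scanned (counters w (regs c B e) out)) = sight_of B w (e 0) (e 1) (e 2) (e 3).
Proof.
rewrite /sight_scan !zero_counters // !one_counters // at_reg_input /regs /=.
congr Sight; try congr Place; try lia.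
rewrite /bits_tape; elim: w (e 1) => [|x w IH] [|p] //=; by rewrite nth_nil.
Qed.

Definition node_bits (k : kind G) : seq bool :=
  true :: encode_option encode_rat None ++ encode_option encode_rat (price k).

Definition pair_bits (adjacent : bool) : seq bool :=
  if adjacent then [:: true; false] else [:: false].

(** The lexicographic order of vertices, on which the upper half of the
    adjacency matrix depends, in terms of the counters 9 to 12, which hold the
    truncated differences of rows and of columns. *)
Definition before (s : cscan) (k k' : kind G) : bool :=
  ~~ zero s 9 || zero s 9 && zero s 10 &&
    (~~ zero s 11 || zero s 11 && zero s 12 && (enum_rank k < enum_rank k')).

Definition print_nodes : cfragment :=
  for_ 0 (for_ 1 (emit (fun _ => flatten [seq node_bits k | k <- enum {: kind G}]))).

Definition print_pair (k : kind G) (s : cscan) : seq bool :=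
  flatten [seq if before s k k' then pair_bits (linked (sight_scan s) k k') else [::]
           | k' <- enum {: kind G}].

Definition print_pairs : cfragment :=
  for_ 0 (for_ 1 (seqfs [seq for_ 2 (for_ 3 (emit (print_pair k))) | k <- enum {: kind G}])).

Definition printer (c D : nat) : cfragment :=
  seqf draw_rulers (seqf (set_bound c D) (seqf (emit (fun _ => encode_rat 0))
    (seqf print_nodes (seqf (emit (fun _ => [:: false])) print_pairs)))).

Definition printer_time (c D n : nat) : nat :=
  let B := (n + c) ^ D in
  let L := \max_(s : cscan) size (flatten [seq node_bits k | k <- enum {: kind G}]) + 1 in
  let L' := \max_(k : kind G) \max_s size (print_pair k s) + 1 in
  2 + (set_bound_time c D n + (\max_(s : cscan) size (encode_rat 0) + 1 +
    (for_time B (for_time B L) + ((\max_(s : cscan) size [:: false] + 1) +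
      for_time B (for_time B (size (enum {: kind G}) * for_time B (for_time B L') + 1)))))).

Lemma polynomial_bound_printer c D : polynomial_bound (printer_time c D).
Proof.
rewrite /printer_time; cbv zeta.
have pB : polynomial_bound (fun n => (n + c) ^ D) by polynomial.
have pS := polynomial_bound_set_bound c D.
repeat first [ exact: polynomial_bound_const | assumption
  | apply: polynomial_bound_for | apply: polynomial_bound_add | apply: polynomial_bound_mul ].
Qed.

Variables (b : nat) (w : seq bool).
Notation B := b.+1.
Notation V := (vertex S b).

Definition vertex_price (v : V) := price v.2.

Lemma vertex_gt0 : 0 < #|V|.
Proof. by apply/card_gt0P; exists (hub S b). Qed.

Definition printed_instance :=
  domination_instance vertex_price (@adj_sym S b w) (@adj_irr S b w) vertex_gt0
    (@adj_connected S b w).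

Definition lex (u v : V) : bool :=
  (u.1.1 < v.1.1) || ((u.1.1 : nat) == v.1.1) &&
    ((u.1.2 < v.1.2) || ((u.1.2 : nat) == v.1.2) && (enum_rank u.2 < enum_rank v.2)).

Lemma enum_rank_vertex u v : (enum_rank u < enum_rank v) = lex u v.
Proof.
case: u v => [[t p] k] [[t' p'] k']; rewrite !enum_rank_pair_lt /lex /= !enum_rank_ord /=.
by rewrite xpair_eqE -!val_eqE /= -orbA -andbA -andb_orr.
Qed.

(** The order in which finite products are enumerated is that of nested loops.
    The restriction to increasing pairs becomes a test in the innermost loop. *)
Lemma encode_printed_instance :
  encode_protection printed_instance =
  flatten [seq flatten [seq flatten [seq node_bits k | k <- enum {: kind G}]
    | p <- iota 0 B] | t <- iota 0 B] ++ [:: false] ++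
  flatten [seq flatten [seq flatten [seq flatten [seq flatten [seq flatten [seq
      (if (t < t') || (t == t') && ((p < p') || (p == p') && (enum_rank k < enum_rank k'))
       then pair_bits (linked (sight_of B w t p t' p') k k') else [::])
    | k' <- enum {: kind G}] | p' <- iota 0 B] | t' <- iota 0 B]
    | k <- enum {: kind G}] | p <- iota 0 B] | t <- iota 0 B].
Proof.
rewrite /encode_protection /encode_seq -catA; congr (_ ++ (_ ++ _)).
  rewrite (eq_map (g := fun i : 'I_#|V| => node_bits (enum_val i).2)); last first.
    move=> i; rewrite /node_bits /encode_node /= !inE.
    by rewrite /vertex_price; case: (price _).
  rewrite (map_comp (fun v : V => node_bits v.2) enum_val) enum_val_enum.
  rewrite (flatten_map_pair (fun v : V => node_bits v.2)).
  rewrite (flatten_map_pair (fun x : 'I_B * 'I_B => flatten [seq node_bits k | k <- enum {: kind G}])).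
  rewrite flatten_enum_ord; congr flatten; apply: eq_map => t.
  by rewrite flatten_enum_ord.
pose F (u v : V) := if lex u v then pair_bits (adj w u v) else [::].
rewrite flatten_allpairs_dep.
transitivity (flatten [seq flatten [seq F u v | v <- enum V] | u <- enum V]).
  rewrite -[enum V]enum_val_enum -map_comp; congr flatten; apply: eq_map => i /=.
  rewrite flatten_filter -map_comp; congr flatten; apply: eq_map => j /=.
  rewrite /F -enum_rank_vertex !enum_valK /encode_pair (mem_index_edges (@adj_sym S b w) (@adj_irr S b w)).
  by rewrite /= inE /pair_bits.
rewrite flatten_map_pair (flatten_map_pair (S := 'I_B)) flatten_enum_ord.
congr flatten; apply: eq_map => t; rewrite flatten_enum_ord.
congr flatten; apply: eq_map => p.
congr flatten; apply: eq_map => k.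
rewrite flatten_map_pair (flatten_map_pair (S := 'I_B)) flatten_enum_ord.
congr flatten; apply: eq_map => t'; rewrite flatten_enum_ord.
congr flatten; apply: eq_map => p'.
congr flatten; apply: eq_map => k'.
by rewrite /F adjE.
Qed.

Lemma computes_printer c D : 0 < c -> B = (size w + c) ^ D ->
  exists T, computes (printer c D) (printer_time c D (size w)) (start_tapes 17 bool w) T
    /\ T.2 ord_max = bits_tape bool (encode_rat 0 ++ encode_protection printed_instance).
Proof.
move=> c0 eB; exists (counters w (regs (size w + c) B (fun=> 0))
  (encode_rat 0 ++ encode_protection printed_instance)); split=> //.
apply: computes_seq (computes_draw_rulers w) _.
apply: computes_seq (computes_set_bound w [::] D c0) _; rewrite -eB.
set h := regs _ _ _; rewrite encode_printed_instance.
apply: prints_from_empty; apply: prints_seq; first exact: prints_emit.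
apply: prints_seq.
  apply: prints_for => // t tB; apply: prints_for => // p pB.
  exact: prints_emit.
apply: prints_seq; first exact: prints_emit.
apply: prints_for => // t tB; apply: prints_for => // p pB.
apply: prints_seqfs => k _.
apply: prints_for => // t' t'B; apply: prints_for => // p' p'B.
apply: (@prints_le _ (\max_s size (print_pair k s) + 1)).
  by rewrite leq_add2r; exact: (leq_bigmax k).
apply: prints_emit_eq; rewrite /print_pair; congr flatten; apply: eq_map => k'.
rewrite sight_scanE /before !zero_counters // /regs /upd /=.
by congr (if _ then _ else _); lia.
Qed.

End Printer.

(** * NP-hardness *)

Lemma polynomial_below_power a d n : a * n ^ d + a < (n + (a.*2 + 2)) ^ d.+1.
Proof.
set m := n + _; have h : n ^ d <= m ^ d.
  by case: d => // d; rewrite leq_exp2r // leq_addr.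
have m0 : 0 < m ^ d by rewrite expn_gt0 /m; lia.
have am : a.*2 + 2 <= m by rewrite /m leq_addl.
rewrite expnS; nia.
Qed.

Theorem mainTheorem3 : NP_hard_min_problem perfect_protection_problem.
Proof.
move=> L [M [T [[a [d Tad]] acc fast]]].
pose c := a.*2 + 2; pose D := d.+1; pose b (w : seq bool) := ((size w + c) ^ D).-1.
have eb (w : seq bool) : (b w).+1 = (size w + c) ^ D by rewrite prednK // expn_gt0 /c; lia.
exists (fun w => encode_rat 0 ++ encode_protection (printed_instance (machine_tiles M) (b w) w)).
split.
  apply: (polytime_of_fragment (polynomial_bound_printer (machine_tiles M) c D)) => w.
  by apply: computes_printer (eb w); rewrite /c; lia.
move=> w; rewrite decision_domination; split=> [Lw|[P [mp dom le0]]].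
  have [t tT wt] := fast w Lw.
  have tB : t < (b w).+1.
    by rewrite eb; apply: leq_ltn_trans (polynomial_below_power a d (size w)); apply: leq_trans tT _.
  have [phi til] := tiling_of_accepts tB wt.
  exists (cover_of (fun x => phi x.1 x.2)); split.
  - by move=> v; rewrite inE /vertex_price; case: v.2.
  - exact: cover_dominates til.
  - by have := cover_price (fun x : 'I_(b w).+1 * 'I_(b w).+1 => phi x.1 x.2 : tile (machine_tiles M)); rewrite /total_price => ->.
have [phi til] := tiling_of_dominating mp dom le0.
exact/acc/(accepts_of_tiling til).
Qed.
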